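(* Let $n\ge2$, $b>0$, $\gamma\in\mathbb R$, $\mu,\kappa>0$, $\sigma'(0)\in\mathbb R$ and $s\ge0$. Suppose that $(u,p,\psi)\in{}_0H^{s+2}(\Omega;\mathbb R^n)\times H^{s+1}(\Omega;\mathbb R)\times{}_0H^{s+2}(\Omega;\mathbb R)$ solve $$\begin{cases} -\gamma\partial_1u+\nabla\cdot(pI-\mu\mathbb Du)=f&\text{in }\Omega\\ \nabla\cdot u=g&\text{in }\Omega\\ -\gamma\partial_1\psi-\kappa\Delta\psi=l&\text{in }\Omega\\ (pI-\mu\mathbb Du)e_n+\sigma'(0)(\nabla'\psi,0)=k&\text{on }\Sigma_b\\ u_n=h&\text{on }\Sigma_b\\ \kappa\partial_n\psi=m&\text{on }\Sigma_b\\ u=0,\ \psi=0&\text{on }\Sigma_0. \end{cases}$$ Let $\chi\in H^{s+1/2}(\Sigma_b;\mathbb R)$ and let $(v,q,\phi)\in{}_0H^{s+2}(\Omega;\mathbb R^n)\times H^{s+1}(\Omega;\mathbb R)\times{}_0H^{s+2}(\Omega;\mathbb R)$ be the unique solution to $$\begin{cases} \gamma\partial_1v+\nabla\cdot(qI-\mu\mathbb Dv)=0&\text{in }\Omega\\ \nabla\cdot v=0&\text{in }\Omega\\ \gamma\partial_1\phi-\kappa\Delta\phi=0&\text{in }\Omega\\ ((qI-\mu\mathbb Dv)e_n)'=0&\text{on }\Sigma_b\\ (qI-\mu\mathbb Dv)e_n\cdot e_n=\chi&\text{on }\Sigma_b\\ \kappa\partial_n\phi+\sigma'(0)\nabla'\cdot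 v'=0&\text{on }\Sigma_b\\ v=0,\ \phi=0&\text{on }\Sigma_0. \end{cases}$$ Then $$\int_\Omega f\cdot v-gq+l\phi=\int_{\Sigma_b}k\cdot v-m\phi-h\chi .$$
   Context: $x=(x',x_n)\in\mathbb R^{n-1}\times\mathbb R$; $\Omega=\mathbb R^{n-1}\times(0,b)$, $\Sigma_b=\{x_n=b\}\cong\mathbb R^{n-1}$, $\Sigma_0=\{x_n=0\}$. For a vector $z\in\mathbb R^n$, $z'$ denotes its first $n-1$ components; primes on differential operators refer to $x'$; $\mathbb Du=\nabla u+(\nabla u)^t$. $H^t$ is the $L^2$-based Sobolev space, ${}_0H^t$ the subspace of functions with zero trace on $\Sigma_0$. The symbol $\sigma'(0)$ is just a real constant (the derivative at $0$ of the surface tension coefficient). The data $f,g,l,k,h,m$ are defined by the left-hand sides of the first system. *)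

(* Defs.v *)
From HB Require Import structures.
From mathcomp Require Import all_boot all_order all_algebra.
From mathcomp Require Import all_classical all_reals all_analysis.

Set Implicit Arguments.
Unset Strict Implicit.
Unset Printing Implicit Defensive.

Import Order.TTheory GRing.Theory Num.Theory.
Import numFieldNormedType.Exports.

Local Open Scope classical_set_scope.
Local Open Scope ring_scope.

(* Points of R^N are row vectors 'rV[R]_N, equipped with the product
   sigma-algebra, i.e. the one generated by the coordinates. *)
Definition rV_display : measure_display.
Proof. exact: default_measure_display. Qed.

Section measurable_rV.
Context (R : realType) (N : nat).

Let coord (i : 'I_N) (x : 'rV[R]_N) : measurableTypeR R := x ord0 i.

Let rV_set0 : g_sigma_preimage coord set0.
Proof. exact: sigma_algebra0. Qed.

Let rV_setC A : g_sigma_preimage coord A -> g_sigma_preimage coord (~` A).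
Proof. exact: sigma_algebraC. Qed.

Let rV_bigcup (F : _^nat) : (forall i, g_sigma_preimage coord (F i)) ->
  g_sigma_preimage coord (\bigcup_i (F i)).
Proof. exact: sigma_algebra_bigcup. Qed.

HB.instance Definition _ := @isMeasurable.Build rV_display
  'rV[R]_N (g_sigma_preimage coord) rV_set0 rV_setC rV_bigcup.

Lemma measurable_coord (i : 'I_N) :
  measurable_fun setT (fun x : 'rV[R]_N => x ord0 i : measurableTypeR R).
Proof.
move=> _ Y mY; rewrite setTI; apply: sub_sigma_algebra => /=.
rewrite -bigcup_seq/=; exists i => /=; first by rewrite mem_index_enum.
by exists Y => //; rewrite setTI.
Qed.

Lemma measurable_rVP d1 (T1 : measurableType d1) (f : T1 -> 'rV[R]_N) :
  (forall i, measurable_fun setT (fun t => f t ord0 i : measurableTypeR R)) ->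
  measurable_fun setT f.
Proof.
move=> mf.
suff prefS : g_sigma_preimage (fun i => coord i \o f) `<=` measurable.
  move: prefS; rewrite g_sigma_preimage_comp => prefS.
  by move=> _ A mA; apply: prefS; exists A.
apply: smallest_sub; first exact: sigma_algebra_measurable.
rewrite -bigcup_seq; apply: bigcup_sub => i _.
by move=> A [B mB <-]; exact: mf.
Qed.

End measurable_rV.

(* (x', t) : R^d * R seen as a point of R^(d+1), with t as last coordinate *)
Definition snoc (R : realType) (d : nat) (x : 'rV[R]_d) (t : R) : 'rV[R]_d.+1 :=
  \row_(j < d.+1) (if unlift ord_max j is Some i then x ord0 i else t).

Section lebesgue_rV_step.
Context (R : realType) (d : nat).
Variable mu : {sigma_finite_measure set 'rV[R]_d -> \bar R}.

Definition snoc_pair (z : 'rV[R]_d * measurableTypeR R) : 'rV[R]_d.+1 :=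
  snoc z.1 z.2.

Definition unsnoc (x : 'rV[R]_d.+1) : 'rV[R]_d * measurableTypeR R :=
  (\row_i x ord0 (lift ord_max i), x ord0 ord_max).

Lemma unsnocK : cancel unsnoc snoc_pair.
Proof.
move=> x; apply/rowP => j; rewrite /snoc_pair /snoc !mxE /=.
by case: unliftP => [i ->|->] /=; rewrite ?mxE.
Qed.

Lemma snoc_pairK : cancel snoc_pair unsnoc.
Proof.
move=> [x t]; congr pair; rewrite ?mxE ?unlift_none//.
by apply/rowP => j; rewrite !mxE liftK.
Qed.

Lemma measurable_snoc_pair : measurable_fun setT snoc_pair.
Proof.
apply: measurable_rVP => j; rewrite /snoc_pair /snoc.
under eq_fun do rewrite mxE.
case: unlift => [i|]; last exact: measurable_snd.
apply: (measurableT_comp (measurable_coord i)); exact: measurable_fst.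
Qed.

Lemma measurable_unsnoc : measurable_fun setT unsnoc.
Proof.
apply: measurable_fun_pair; last exact: measurable_coord.
apply: measurable_rVP => i; under eq_fun do rewrite mxE.
exact: measurable_coord.
Qed.

Let leb : {sigma_finite_measure set (measurableTypeR R) -> \bar R} :=
  @lebesgue_measure R.
Let prod : {measure set ('rV[R]_d * measurableTypeR R)%type -> \bar R} :=
  (mu \x leb)%E.

Definition snoc_measure : set 'rV[R]_d.+1 -> \bar R :=
  pushforward (mu \x @lebesgue_measure R)%E snoc_pair.

Let snoc_measure0 : snoc_measure set0 = 0%E.
Proof. by rewrite /snoc_measure /pushforward preimage_set0 (measure0 prod). Qed.

Let snoc_measure_ge0 A : (0 <= snoc_measure A)%E.
Proof. exact: (measure_ge0 prod). Qed.

Let snoc_measure_sigma_additive : semi_sigma_additive snoc_measure.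
Proof.
exact: (@measure_semi_sigma_additive _ _ _
  (measure_function_pushforward__canonical__measure_function_Measure
     prod measurable_snoc_pair)).
Qed.

HB.instance Definition _ := isMeasure.Build _ _ _ snoc_measure
  snoc_measure0 snoc_measure_ge0 snoc_measure_sigma_additive.

Let snoc_measure_sigma_finite : sigma_finite setT snoc_measure.
Proof.
have /sigma_finiteP[F [TF ndF Foo]] := sigma_finiteT mu.
have /sigma_finiteP[G [TG ndG Goo]] := sigma_finiteT leb.
exists (fun k => unsnoc @^-1` (F k `*` G k)).
  rewrite -preimage_bigcup (_ : \bigcup_k _ = setT) ?preimage_setT//.
  rewrite -setXTT TF TG predeqE => -[x y]; split.
    by move=> [n _ []/= ? ?]; split; exists n.
  move=> [/= [n _ Fnx] [k _ Gky]]; exists (maxn n k) => //; split.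
  - by move: x Fnx; exact/subsetPset/ndF/leq_maxl.
  - by move: y Gky; exact/subsetPset/ndG/leq_maxr.
move=> k; have [? ?] := Foo k; have [? ?] := Goo k; split.
  by rewrite -[X in measurable X]setTI; apply: measurable_unsnoc => //;
    exact: measurableX.
rewrite /snoc_measure /pushforward -comp_preimage.
rewrite (_ : unsnoc \o snoc_pair = id); last exact/funext/snoc_pairK.
by rewrite preimage_id product_measure1E// lte_mul_pinfty// ge0_fin_numE.
Qed.

HB.instance Definition _ := Measure_isSigmaFinite.Build _ _ _ snoc_measure
  snoc_measure_sigma_finite.

End lebesgue_rV_step.

Fixpoint lebesgue_rV (R : realType) (N : nat) :
    {sigma_finite_measure set 'rV[R]_N -> \bar R} :=
  match N with
  | 0 => @dirac _ 'rV[R]_0 0 R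
  | d.+1 => snoc_measure (lebesgue_rV R d)
  end.

Section sobolev_spaces.
Context (R : realType) (N : nat).
Implicit Types (U : set 'rV[R]_N) (u w phi : 'rV[R]_N -> R) (i : 'I_N).
Notation leb := (lebesgue_rV R N).

Definition L2 U u :=
  measurable_fun U u /\ (\int[leb]_(x in U) ((u x) ^+ 2)%:E < +oo)%E.

Definition cvgL2 U (phi : nat -> 'rV[R]_N -> R) u :=
  (fun m => \int[leb]_(x in U) ((phi m x - u x) ^+ 2)%:E)%E @ \oo --> 0%E.

Definition partial i phi : 'rV[R]_N -> R := 'D_(delta_mx ord0 i) phi.

Definition smooth phi := forall s : seq 'I_N,
  let Dphi := foldr partial phi s in
  continuous Dphi /\ forall i x, derivable Dphi x (delta_mx ord0 i).

(* C_c^oo(U) *)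
Definition test_function U phi := smooth phi /\
  exists K, [/\ compact K, K `<=` U & forall x, ~ K x -> phi x = 0].

Definition is_wderiv U i u w := L2 U w /\
  forall phi, test_function U phi ->
    \int[leb]_(x in U) (u x * partial i phi x) =
    - \int[leb]_(x in U) (w x * phi x).

(* The weak derivative D_i u in L2(U), determined up to a null set whenever it
   exists; the junk value when it does not exist is excluded by [sobolev_frac]. *)
Definition wderiv U i u : 'rV[R]_N -> R :=
  xget (fun=> 0) [set w | is_wderiv U i u w].

Definition has_wderiv U i u := is_wderiv U i u (wderiv U i u).

Definition enorm (x : 'rV[R]_N) : R := Num.sqrt (\sum_i (x ord0 i) ^+ 2).

(* Gagliardo-Slobodeckij seminorm (squared) of order theta in (0, 1) *)
Definition gagliardo U (theta : R) u : \bar R :=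
  (\int[leb]_(x in U) \int[leb]_(y in U)
    ((u x - u y) ^+ 2 / enorm (x - y) `^ (N%:R + 2 * theta))%:E)%E.

(* u and its weak derivatives up to order k are in L2(U), and the derivatives
   of order k have a finite seminorm of order theta if theta > 0 *)
Fixpoint sobolev_frac (k : nat) (theta : R) U u : Prop :=
  L2 U u /\
  match k with
  | 0 => 0 < theta -> (gagliardo U theta u < +oo)%E
  | k'.+1 => forall i, has_wderiv U i u /\ sobolev_frac k' theta U (wderiv U i u)
  end.

(* H^t(U) = W^{t,2}(U), for t >= 0, in its Sobolev-Slobodeckij form *)
Definition sobolev (t : R) U u :=
  sobolev_frac (Num.truncn t) (t - (Num.truncn t)%:R) U u.

End sobolev_spaces.

Section slab.
Context (R : realType) (d : nat).
Local Notation E := 'rV[R]_d.+1.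

Definition slab (b : R) : set E := [set x | 0 < x ord0 ord_max < b].

(* [w] is the trace of [u \in H^1(slab b)] on the plane x_n = c, where c is 0
   or b: the value at u of the continuous extension to H^1 of the restriction
   map phi |-> phi(., c), phi \in C_c^oo(R^n). *)
Definition has_trace (b c : R) (u : E -> R) (w : 'rV[R]_d -> R) :=
  [/\ sobolev 1 (slab b) u, L2 setT w &
    exists phi : nat -> E -> R,
      [/\ forall m, test_function setT (phi m),
          cvgL2 (slab b) phi u,
          forall i, cvgL2 (slab b) (fun m => partial i (phi m))
                      (wderiv (slab b) i u) &
          cvgL2 setT (fun m x' => phi m (snoc x' c)) w]].

Definition trace (b c : R) (u : E -> R) : 'rV[R]_d -> R :=
  xget (fun=> 0) [set w | has_trace b c u w].

(* {}_0H^t(slab b) *)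
Definition sobolev0 (b t : R) (u : E -> R) :=
  sobolev t (slab b) u /\ has_trace b 0 u (fun=> 0).

(* A vector field is given by its components; the indices of x_1 and x_n are
   ord0 and ord_max, those of x' are the [lift ord_max i], i < d = n - 1. *)
Implicit Types (p q psi : E -> R) (u v : 'I_d.+1 -> E -> R).

Section operators.
Variable b : R.
Local Notation D := (wderiv (slab b)).

Definition diverg u : E -> R := fun x => \sum_i D i (u i) x.

Definition laplacian psi : E -> R := fun x => \sum_i D i (D i psi) x.

Definition symgrad u (i j : 'I_d.+1) : E -> R :=
  fun x => D i (u j) x + D j (u i) x.

Definition stress (mu : R) p u (i j : 'I_d.+1) : E -> R :=
  fun x => p x *+ (i == j) - mu * symgrad u i j x.

Definition div_stress (mu : R) p u (j : 'I_d.+1) : E -> R :=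
  diverg (fun i => stress mu p u i j).

(* (\nabla' psi, 0) *)
Definition hgrad psi (j : 'I_d.+1) : E -> R :=
  fun x => if j == ord_max then 0 else D j psi x.

(* \nabla' . v' *)
Definition hdiverg v : E -> R :=
  fun x => \sum_(i < d) D (lift ord_max i) (v (lift ord_max i)) x.

End operators.

Record primal_system (b gamma mu kappa sigma1 : R)
    (f : 'I_d.+1 -> E -> R) (g l : E -> R)
    (k : 'I_d.+1 -> 'rV[R]_d -> R) (h m : 'rV[R]_d -> R)
    u p psi : Prop := PrimalSystem {
  primal_momentum : forall j, ae_eq (lebesgue_rV R d.+1) (slab b)
    (fun x => - gamma * wderiv (slab b) ord0 (u j) x + div_stress b mu p u j x)
    (f j);
  primal_divergence : ae_eq (lebesgue_rV R d.+1) (slab b) (diverg b u) g;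
  primal_diffusion : ae_eq (lebesgue_rV R d.+1) (slab b)
    (fun x => - gamma * wderiv (slab b) ord0 psi x - kappa * laplacian b psi x)
    l;
  primal_stress_top : forall j, has_trace b b
    (fun x => stress b mu p u j ord_max x + sigma1 * hgrad b psi j x) (k j);
  primal_normal_top : has_trace b b (u ord_max) h;
  primal_flux_top : has_trace b b
    (fun x => kappa * wderiv (slab b) ord_max psi x) m;
  primal_bottom_u : forall j, has_trace b 0 (u j) (fun=> 0);
  primal_bottom_psi : has_trace b 0 psi (fun=> 0)
}.

Record dual_system (b gamma mu kappa sigma1 : R) (chi : 'rV[R]_d -> R)
    v q (phi : E -> R) : Prop := DualSystem {
  dual_momentum : forall j, ae_eq (lebesgue_rV R d.+1) (slab b)
    (fun x => gamma * wderiv (slab b) ord0 (v j) x + div_stress b mu q v j x)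
    (fun=> 0);
  dual_divergence :
    ae_eq (lebesgue_rV R d.+1) (slab b) (diverg b v) (fun=> 0);
  dual_diffusion : ae_eq (lebesgue_rV R d.+1) (slab b)
    (fun x => gamma * wderiv (slab b) ord0 phi x - kappa * laplacian b phi x)
    (fun=> 0);
  dual_tangential_top : forall j, j != ord_max ->
    has_trace b b (stress b mu q v j ord_max) (fun=> 0);
  dual_normal_top : has_trace b b (stress b mu q v ord_max ord_max) chi;
  dual_flux_top : has_trace b b
    (fun x => kappa * wderiv (slab b) ord_max phi x + sigma1 * hdiverg b v x)
    (fun=> 0);
  dual_bottom_v : forall j, has_trace b 0 (v j) (fun=> 0);
  dual_bottom_phi : has_trace b 0 phi (fun=> 0)
}.

End slab.

(* Main.v *)
(** Only products [A V] whose factor [V] vanishes at the bottom are integrated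
    by parts.  Such a [V] is, by the very definition of its trace, an H^1 limit
    of restrictions of functions in C_c^oo(R^n), so everything reduces to test
    functions of R^n, and neither the density of smooth functions in H^1 of the
    slab nor the a.e. uniqueness of weak derivatives is needed.

    In a horizontal direction, a cutoff in x_n turns a test function of R^n into
    a test function of the slab without touching the derivative, so the
    definition of weak derivatives suffices.  In the vertical direction, the
    trace of [V] at x_n = c is the fibre integral of [D_n (a V)] for an affine
    weight [a]; this is L^2-continuous in the H^1 norm, so that traces exist,
    are unique, and the Green formula passes to the limit.

    Testing the primal momentum and heat equations with [v] and [phi], and the
    dual ones with [u] and [psi], the drift terms are opposite, the viscous and
    heat conduction forms are symmetric, and the two surface tension terms are
    opposite after integrating by parts along the surface. *)
Require Import Defs.
From mathcomp Require Import all_boot all_order all_algebra.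
From mathcomp Require Import all_classical all_reals all_analysis.
From mathcomp Require Import measurable_realfun lra ring.
Set Implicit Arguments.
Unset Strict Implicit.
Unset Printing Implicit Defensive.
Import Order.TTheory GRing.Theory Num.Theory.
Import numFieldNormedType.Exports.
Local Open Scope classical_set_scope.
Local Open Scope ring_scope.

(** * Square-integrable functions *)

Lemma cvg_seq_unique (R : realType) (u : nat -> R) (l l' : R) :
  u n @[n --> \oo] --> l -> u n @[n --> \oo] --> l' -> l = l'.
Proof. by move=> ul ul'; exact: (norm_cvg_unique ul ul'). Qed.

Section square_integrable.
Context d (T : measurableType d) (R : realType).
Variable mu : {measure set T -> \bar R}.
Variable D : set T.
Hypothesis mD : measurable D.
Implicit Types f g : T -> R.

(** [L2] over an arbitrary measure, so that the same calculus serves the slab, the boundary plane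
    and the vertical fibres; [cvg_sqint] below plays the same part for [cvgL2]. *)
Definition sqint f :=
  measurable_fun D f /\ (\int[mu]_(x in D) ((f x) ^+ 2)%:E < +oo)%E.

Definition dot f g : R := \int[mu]_(x in D) (f x * g x).

Lemma integrable_sqint f : measurable_fun D f ->
  mu.-integrable D (EFin \o (fun x => f x ^+ 2)) <-> sqint f.
Proof.
move=> mf.
have E : (\int[mu]_(x in D) `|(f x ^+ 2)%:E| =
  \int[mu]_(x in D) (f x ^+ 2)%:E)%E.
  by apply: eq_integral => x _ /=; rewrite ger0_norm ?sqr_ge0.
split=> [/integrableP[_]|[_ foo]]; first by rewrite /= E.
apply/integrableP; split; last by rewrite /= E.
by apply/measurable_EFinP; exact: measurable_funX.
Qed.

Lemma sqint_mul f g : sqint f -> sqint g ->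
  mu.-integrable D (EFin \o (fun x => f x * g x)).
Proof.
move=> sf sg.
have i : mu.-integrable D
    ((EFin \o (fun x => (f x ^+ 2)%R)) \+ (EFin \o (fun x => (g x ^+ 2)%R)))%E.
  by apply: integrableD => //; apply/integrable_sqint => //;
    [case: sf|case: sg].
apply: (le_integrable mD _ _ i).
  by apply/measurable_EFinP; apply: measurable_funM; [case: sf|case: sg].
move=> x _ /=; rewrite lee_fin [leRHS]ger0_norm ?addr_ge0 ?sqr_ge0// ler_norml.
apply/andP; split; nra.
Qed.

Lemma sqintD f g : sqint f -> sqint g -> sqint (fun x => f x + g x).
Proof.
move=> sf sg; apply/integrable_sqint.
  by apply: measurable_funD; [case: sf|case: sg].
rewrite (_ : _ \o _ = ((EFin \o (fun x => (f x * f x)%R)) \+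
  ((EFin \o (fun x => (f x * g x)%R)) \+
  ((EFin \o (fun x => (f x * g x)%R)) \+ (EFin \o (fun x =>
    (g x * g x)%R))))))%E.
  by do 3![apply: integrableD; rewrite //; first exact: sqint_mul];
    exact: sqint_mul.
by apply/funext => x /=; rewrite -!EFinD; congr EFin; ring.
Qed.

Lemma sqintZ c f : sqint f -> sqint (fun x => c * f x).
Proof.
move=> sf; apply/integrable_sqint.
  by apply: measurable_funM => //; case: sf.
rewrite (_ : _ \o _ =
    (fun x => (c ^+ 2)%:E * (EFin \o (fun x => (f x * f x)%R)) x))%E.
  by apply: integrableZl => //; exact: sqint_mul.
by apply/funext => x /=; rewrite -!EFinM; congr EFin; ring.
Qed.

Lemma sqintB f g : sqint f -> sqint g -> sqint (fun x => f x - g x).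
Proof.
move=> sf /(sqintZ (-1)) /(sqintD sf).
by under eq_fun do rewrite mulN1r.
Qed.

Lemma sqint0 : sqint (fun=> 0).
Proof.
split=> //; under eq_integral do rewrite expr0n/=.
by rewrite integral0.
Qed.

Lemma sqint_sum n (F : 'I_n -> T -> R) : (forall i, sqint (F i)) ->
  sqint (fun x => \sum_i F i x).
Proof.
move=> sF; rewrite (_ : (fun x => _) = \sum_i F i); last first.
  by apply/funext => x; rewrite fct_sumE.
by elim/big_ind : _ => [||//]; [exact: sqint0|exact: sqintD].
Qed.

(** [g] is assumed measurable because a.e. equality does not transfer measurability over a measure
    that may be incomplete; this is why the theorem asks for measurable data. *)
Lemma ae_eq_sqint f g : measurable_fun D g -> ae_eq mu D f g ->
  sqint f -> sqint g.
Proof.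
move=> mg fg [mf foo]; split => //.
suff -> : (\int[mu]_(x in D) ((g x) ^+ 2)%:E =
  \int[mu]_(x in D) ((f x) ^+ 2)%:E)%E by [].
apply: ae_eq_integral => //;
  do ?by apply/measurable_EFinP; exact: measurable_funX.
by apply: filterS fg => x /= fg Dx; rewrite fg.
Qed.

Lemma sqint_bounded_mul (M : R) f g : measurable_fun D g ->
  (forall x, D x -> `|g x| <= M) -> sqint f -> sqint (fun x => g x * f x).
Proof.
move=> mg gM sf; have mf := sf.1; apply/integrable_sqint;
  first exact: measurable_funM.
have /(integrable_sqint (measurable_funM
  (measurable_cst M) mf)) i := sqintZ M sf.
apply: le_integrable i => //; first by
  apply/measurable_EFinP/measurable_funX/measurable_funM.
move=> x Dx /=; rewrite !ger0_norm ?sqr_ge0// lee_fin !exprMn.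
rewrite ler_wpM2r ?sqr_ge0// -real_normK ?num_real// lerXn2r ?nnegrE// ?gM//.
by rewrite (le_trans _ (gM _ Dx)).
Qed.

Lemma dotC f g : dot f g = dot g f.
Proof. by apply: eq_Rintegral => x _; rewrite mulrC. Qed.

Lemma dotDl f g h : sqint f -> sqint g -> sqint h ->
  dot (fun x => f x + g x) h = dot f h + dot g h.
Proof.
move=> sf sg sh; rewrite /dot -RintegralD//; do ?exact: sqint_mul.
by apply: eq_Rintegral => x _; rewrite mulrDl.
Qed.

Lemma dotZl c f h : sqint f -> sqint h ->
    dot (fun x => c * f x) h = c * dot f h.
Proof.
move=> sf sh; rewrite /dot -RintegralZl//; last exact: sqint_mul.
by apply: eq_Rintegral => x _; rewrite mulrA.
Qed.

Lemma dotBl f g h : sqint f -> sqint g -> sqint h ->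
  dot (fun x => f x - g x) h = dot f h - dot g h.
Proof.
move=> sf sg sh; rewrite /dot -RintegralB//; do ?exact: sqint_mul.
by apply: eq_Rintegral => x _; rewrite mulrBl.
Qed.

Lemma dotDr f g h : sqint f -> sqint g -> sqint h ->
  dot h (fun x => f x + g x) = dot h f + dot h g.
Proof. by move=> sf sg sh; rewrite dotC dotDl// !(dotC _ h). Qed.

Lemma dotZr c f h : sqint f -> sqint h ->
    dot h (fun x => c * f x) = c * dot h f.
Proof. by move=> sf sh; rewrite dotC dotZl// dotC. Qed.

Lemma dotBr f g h : sqint f -> sqint g -> sqint h ->
  dot h (fun x => f x - g x) = dot h f - dot h g.
Proof. by move=> sf sg sh; rewrite dotC dotBl// !(dotC _ h). Qed.

Lemma dot0l f : dot (fun=> 0) f = 0.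
Proof.
rewrite /dot; under eq_Rintegral do rewrite mul0r.
by rewrite /Rintegral integral0.
Qed.

Lemma dot_suml n (F : 'I_n -> T -> R) h : (forall i, sqint (F i)) -> sqint h ->
  dot (fun x => \sum_i F i x) h = \sum_i dot (F i) h.
Proof.
elim: n F => [|n IH] F sF sh.
  by under eq_fun do rewrite big_ord0; rewrite dot0l big_ord0.
under eq_fun do rewrite big_ord_recl.
by rewrite dotDl//; [rewrite IH// big_ord_recl|exact: sqint_sum].
Qed.

Lemma eq_ae_dot f g h : sqint f -> sqint h -> measurable_fun D g ->
  ae_eq mu D f g -> dot f h = dot g h.
Proof.
move=> [mf _] [mh _] mg fg; rewrite /dot /Rintegral; congr fine.
apply: ae_eq_integral => //; do ?by apply/measurable_EFinP;
  exact: measurable_funM.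
by apply: filterS fg => x /= fg Dx; rewrite fg.
Qed.

Lemma dot_ge0 f : 0 <= dot f f.
Proof. by apply: Rintegral_ge0 => x _; rewrite -expr2 sqr_ge0. Qed.

(** The quadratic polynomial [t |-> dot (f + t g) (f + t g)] is nonnegative. *)
Lemma cauchy_schwarz f g : sqint f -> sqint g ->
  `|dot f g| <= Num.sqrt (dot f f) * Num.sqrt (dot g g).
Proof.
move=> sf sg; rewrite -sqrtr_sqr -sqrtrM ?dot_ge0//.
rewrite ler_sqrt ?mulr_ge0 ?dot_ge0//.
set B := dot f g.
have key t : 0 <= dot f f + 2 * t * B + t ^+ 2 * dot g g.
  have := dot_ge0 (fun x => f x + t * g x).
  have stg := sqintZ t sg; have s := sqintD sf stg.
  rewrite dotDl// dotZl// !dotDr// !dotZr// (dotC g f) -/B; move/le_trans;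
    apply; rewrite le_eqVlt; apply/orP; left.
  by apply/eqP; ring.
have := dot_ge0 g; rewrite le_eqVlt => /orP[/eqP g0|g0].
  (* In the degenerate case the polynomial is affine in [t]; if [B] were nonzero, this choice of [t]
     would give it the value -1. *)
  rewrite -g0 mulr0; have := key (- (dot f f + 1) / (2 * B)).
  have [->|B0] := eqVneq B 0; first by rewrite expr0n.
  rewrite -g0 mulr0 addr0 (_ : 2 * _ * _ = - (dot f f + 1)); last by field.
  by rewrite opprD addrA subrr add0r ler0N1.
(* The minimiser of the quadratic polynomial. *)
have := key (- B / dot g g).
rewrite (_ : _ + _ = dot f f - B ^+ 2 / dot g g); last by field; rewrite gt_eqF.
by rewrite subr_ge0 ler_pdivrMr.
Qed.

Definition cvg_sqint (F : nat -> T -> R) f :=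
  (fun m => \int[mu]_(x in D) ((F m x - f x) ^+ 2)%:E)%E @ \oo --> 0%E.

Lemma cvg_sqintP F f : (forall m, sqint (F m)) -> sqint f ->
  cvg_sqint F f <->
  dot (fun x => F m x - f x) (fun x => F m x - f x) @[m --> \oo] --> 0.
Proof.
move=> sF sf; rewrite /cvg_sqint.
rewrite (_ : (fun m => _) = EFin \o (fun m : nat =>
  dot (fun x => F m x - f x) (fun x => F m x - f x))); last first.
  apply/funext => m /=; rewrite /dot /Rintegral fineK//.
  by apply: integrable_fin_num => //; exact/sqint_mul/sqintB/sf/sF/sqintB.
by split => [/fine_cvgP[]//|h]; apply/fine_cvgP; split => //; near=> x.
Unshelve. all: by end_near. Qed.

(** The difference of the two products splits as (F - f, G - g) + (F - f, g) + (f, G - g), and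
    Cauchy-Schwarz bounds each term. *)
Lemma cvg_dot F f G g : (forall m, sqint (F m)) -> sqint f ->
  (forall m, sqint (G m)) -> sqint g -> cvg_sqint F f -> cvg_sqint G g ->
  dot (F m) (G m) @[m --> \oo] --> dot f g.
Proof.
move=> sF sf sG sg /(cvg_sqintP sF sf) cF /(cvg_sqintP sG sg) cG.
pose df m := dot (fun x => F m x - f x) (fun x => F m x - f x).
pose dg m := dot (fun x => G m x - g x) (fun x => G m x - g x).
have sFf m := sqintB (sF m) sf; have sGg m := sqintB (sG m) sg.
have E m : dot (F m) (G m) - dot f g =
    dot (fun x => F m x - f x) (fun x => G m x - g x) +
    dot (fun x => F m x - f x) g + dot f (fun x => G m x - g x).
  by rewrite !dotBl// !dotBr//; ring.
have sq0 (u : nat -> R) : u @ \oo --> 0 -> Num.sqrt (u m) @[m --> \oo] --> 0.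
  move=> u0; rewrite -[X in _ --> X](@sqrtr0 R).
  exact: (continuous_cvg _ (@sqrt_continuous R 0) u0).
rewrite -subr_cvg0; apply/norm_cvg0P.
apply: (@squeeze_cvgr _ _ _ _ (fun=> 0) (fun m =>
  Num.sqrt (df m) * Num.sqrt (dg m) + Num.sqrt (df m) * Num.sqrt (dot g g) +
  Num.sqrt (dot f f) * Num.sqrt (dg m))); last 2 first.
- exact: cvg_cst.
- rewrite -[X in _ --> X](_ : 0 * 0 + 0 * Num.sqrt (dot g g) +
      Num.sqrt (dot f f) * 0 = 0); last by rewrite !(mul0r, mulr0) !addr0.
  by apply: cvgD; [apply: cvgD|]; apply: cvgM; (exact: cvg_cst || exact: sq0).
near=> m; rewrite normr_ge0/= E (le_trans (ler_normD _ _))// lerD//.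
  by rewrite (le_trans (ler_normD _ _))// lerD// cauchy_schwarz.
exact: cauchy_schwarz.
Unshelve. all: by end_near. Qed.

Lemma cvg_sqint_cst f : cvg_sqint (fun=> f) f.
Proof.
rewrite /cvg_sqint (_ : (fun _ => _) = (fun=> 0%E)); first exact: cvg_cst.
apply/funext => m; under eq_integral do rewrite subrr expr0n/=.
by rewrite integral0.
Qed.

(** An L^2 limit is determined only up to a null set; testing against [g] is the form in which its
    uniqueness is used for traces. *)
Lemma cvg_sqint_dot_unique F f f' g : (forall m, sqint (F m)) -> sqint f ->
  sqint f' -> sqint g -> cvg_sqint F f -> cvg_sqint F f' -> dot g f = dot g f'.
Proof.
move=> sF sf sf' sg cf cf'; have cg := cvg_sqint_cst g.
exact: (cvg_seq_unique (cvg_dot (fun=> sg) sg sF sf cg cf)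
  (cvg_dot (fun=> sg) sg sF sf' cg cf')).
Qed.

Lemma cvg_sqintD F f G g : (forall m, sqint (F m)) -> sqint f ->
  (forall m, sqint (G m)) -> sqint g -> cvg_sqint F f -> cvg_sqint G g ->
  cvg_sqint (fun m x => F m x + G m x) (fun x => f x + g x).
Proof.
move=> sF sf sG sg /(cvg_sqintP sF sf) cF /(cvg_sqintP sG sg) cG.
have sFG m := sqintD (sF m) (sG m); have sfg := sqintD sf sg.
apply/(cvg_sqintP sFG sfg).
have c0 := cvgM (cvg_cst (2 : R)) (cvgD cF cG); rewrite addr0 mulr0 in c0.
apply: (@squeeze_cvgr _ _ _ _ (fun=> 0) (fun m =>
    2 * (dot (fun x => F m x - f x) (fun x => F m x - f x) +
    dot (fun x => G m x - g x) (fun x => G m x - g x)))); last 2 first.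
- exact: cvg_cst.
- exact: c0.
near=> m; rewrite dot_ge0/=.
have sFf := sqintB (sF m) sf; have sGg := sqintB (sG m) sg.
have -> : (fun x => F m x + G m x - (f x + g x)) =
    (fun x => (F m x - f x) + (G m x - g x)).
  by apply/funext => x; ring.
(* Expanding the squared norm of u - v, which is nonnegative, gives |u + v|^2 <= 2 (|u|^2 +
   |v|^2). *)
have := dot_ge0 (fun x => (F m x - f x) - (G m x - g x)).
move: sFf sGg; set u := (fun x => F m x - f x); set v := (fun x => G m x - g x).
move=> su sv; rewrite (dotBl su sv (sqintB su sv)) (dotBr su sv su)
  (dotBr su sv sv).
rewrite (dotDl su sv (sqintD su sv)) (dotDr su sv su) (dotDr su sv sv)
  (dotC v u).
by lra.
Unshelve. all: by end_near. Qed.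

Lemma cvg_sqintM (M : R) g F f : measurable_fun D g ->
  (forall x, D x -> `|g x| <= M) -> (forall m, sqint (F m)) -> sqint f ->
  cvg_sqint F f -> cvg_sqint (fun m x => g x * F m x) (fun x => g x * f x).
Proof.
move=> mg gM sF sf /(cvg_sqintP sF sf) cF.
have sgF m := sqint_bounded_mul mg gM (sF m);
  have sgf := sqint_bounded_mul mg gM sf.
apply/(cvg_sqintP sgF sgf).
have c0 := cvgM (cvg_cst (M ^+ 2)) cF; rewrite mulr0 in c0.
apply: (@squeeze_cvgr _ _ _ _ (fun=> 0) (fun m =>
    M ^+ 2 * dot (fun x => F m x - f x) (fun x => F m x - f x))); last 2 first.
- exact: cvg_cst.
- exact: c0.
near=> m; rewrite dot_ge0/=.
have sFf := sqintB (sF m) sf; have sgFf := sqintB (sgF m) sgf.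
rewrite /dot -RintegralZl//; last exact: sqint_mul.
apply: le_Rintegral => //; first exact: sqint_mul.
  by have := sqint_mul (sqintZ (M ^+ 2) sFf) sFf;
    under eq_fun do rewrite /= -mulrA.
move=> x Dx; rewrite -mulrBr -!expr2 exprMn ler_wpM2r ?sqr_ge0//.
rewrite -real_normK ?num_real// lerXn2r ?nnegrE// ?gM//.
exact: le_trans (gM _ Dx).
Unshelve. all: by end_near. Qed.

End square_integrable.

(** * Euclidean space *)

Section rV_measurability.
Context (R : realType) (N : nat).
Notation leb := (lebesgue_rV R N).

Definition box (M : R) : set 'rV[R]_N := [set x | forall j, `|x ord0 j| <= M].

Lemma measurable_cap_coord (F : 'I_N -> set R) : (forall j, measurable (F j)) ->
  measurable [set x : 'rV[R]_N | forall j, F j (x ord0 j)].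
Proof.
move=> mF; rewrite (_ : mkset _ =
    \bigcap_(j in [set: 'I_N]) ((fun x : 'rV[R]_N => x ord0 j) @^-1` F j)).
  apply: fin_bigcap_measurable => [|j _]; first exact: finite_finset.
  by rewrite -[X in measurable X]setTI; apply: measurable_coord => //;
    exact: mF.
by apply/seteqP; split => x /= Fx j; [move=> _|]; exact: Fx.
Qed.

Lemma measurable_box M : measurable (box M).
Proof.
apply: (measurable_cap_coord (F := fun=> [set t | `|t| <= M])) => j.
rewrite (_ : mkset _ = `[- M, M]%classic)//.
by apply/seteqP; split => t /=; rewrite in_itv/= ler_norml.
Qed.

(** The sigma-algebra is generated by the coordinates, so an open set is written as the countable
    union of the rational open cubes that it contains. *)
Lemma open_measurable_rV (A : set 'rV[R]_N) : open A -> measurable A.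
Proof.
move=> oA.
pose B (c : 'rV[rat]_N * rat) : set 'rV[R]_N :=
  [set x | forall j, `](ratr (c.1 ord0 j - c.2)), (ratr (c.1 ord0 j +
    c.2))[%classic (x ord0 j)].
have mB c : measurable (B c).
  apply: (measurable_cap_coord (F := fun j =>
    `](ratr (c.1 ord0 j - c.2)), (ratr (c.1 ord0 j + c.2))[%classic)) => j.
  exact: measurable_itv.
rewrite (_ : A = \bigcup_(c in [set c | B c `<=` A]) B c); last first.
  apply/seteqP; split => [x Ax|x [c cA Bx]]; last exact: cA.
  have /nbhs_ballP[e /= e0 xeA] := open_nbhs_nbhs (conj oA Ax).
  (* A cube of radius [r] whose centre is within [r] of [x] contains [x] and has all its points
     within [2 r < e] of it. *)
  have /rat_in_itvoo[r] : 0 < e / 2 by rewrite divr_gt0.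
  rewrite in_itv/= => /andP[r0 re].
  have H j : {z : rat | ratr z \in `](x ord0 j - ratr r), (x ord0 j + ratr r)[}.
    by apply/cid/rat_in_itvoo; lra.
  exists (\row_j sval (H j), r).
    move=> y By; apply: xeA; split => // i j; rewrite ord1.
    move: (By j); rewrite /= mxE in_itv/= !rmorphB !rmorphD/=.
    case: (H j) => z /=; rewrite in_itv/= => /andP[? ?] /andP[? ?].
    by rewrite /ball/= ltr_norml; apply/andP; split; lra.
  move=> j; rewrite /= mxE !in_itv/= rmorphB rmorphD/=.
  by case: (H j) => z /=; rewrite in_itv/= => /andP[? ?]; apply/andP; split;
    lra.
rewrite bigcup_mkcond; apply: countable_bigcupT_measurable => [|c].
  exact: countableP.
by case: ifP.
Qed.

Lemma continuous_measurable_rV (f : 'rV[R]_N -> R) : continuous f ->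
  measurable_fun setT f.
Proof.
move=> cf; apply: (measurability _ (RGenOInfty.measurableE R)) => //.
move=> _ [_ [a ->] <-]; rewrite setTI; apply: open_measurable_rV.
by apply: open_comp; [move=> x _; exact: cf|exact: interval_open].
Qed.

Lemma compact_sub_box (K : set 'rV[R]_N) : compact K -> exists M, K `<=` box M.
Proof.
move=> /compact_bounded[M [_ KM]]; exists (M + 1) => x Kx j.
have := KM (M + 1) _ x Kx; rewrite ltrDl => /(_ ltr01); apply: le_trans.
by rewrite /Num.Def.normr/= mx_normrE (le_bigmax_cond _ (fun ij =>
  `|x ij.1 ij.2|) (j := (ord0, j))).
Qed.

End rV_measurability.

(** Through [snoc_pair], a box in dimension d + 1 is the product of a box in dimension d and an
    interval. *)
Lemma lebesgue_box_fin (R : realType) N M : (lebesgue_rV R N (@box R N M) <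
    +oo)%E.
Proof.
elim: N => [|d IH].
  by rewrite /= diracE; case: (_ \in _); rewrite ltry.
rewrite [X in (X < _)%E](_ : _ = (lebesgue_rV R d (@box R d M) *
    @lebesgue_measure R `[(- M)%R, M]%classic)%E).
  by rewrite lte_mul_pinfty ?ge0_fin_numE//= lebesgue_measure_itv/=; case: ifP;
    rewrite ltry.
rewrite -product_measure1E//; last exact: measurable_box.
rewrite /= /snoc_measure /pushforward; congr (_ _).
apply/seteqP; split => [[x t] /= H|[x t] /= [xM tM] j]; last first.
  rewrite /snoc_pair mxE; case: unliftP => [i _|_]; first exact: xM.
  by move: tM; rewrite in_itv/= ler_norml.
split => [j|].
  by have := H (lift ord_max j); rewrite /snoc_pair mxE liftK.
by have := H ord_max; rewrite /snoc_pair mxE unlift_none/= in_itv/= ler_norml.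
Qed.

(** * Smooth functions and cutoffs *)

Section flat_function.
Context (R : realType).
Implicit Types (P : {poly R}) (x y : R).

(** [flat 1] is the classical smooth function exp(-1/x) extended by 0; the polynomial [P] in 1/x
    makes the family stable under differentiation. *)
Definition flat P x : R := if 0 < x then P.[x^-1] * expR (- x^-1) else 0.

Lemma exprM_expRN_le1 n y : 0 <= y -> y ^+ n * expR (- y) <= n`!%:R.
Proof.
move=> y0; rewrite expRN ler_pdivrMr ?expR_gt0//.
case: n => [|n]; first by rewrite expr0 fact0 mul1r -{1}expR0 ler_expR.
have := expR_ge1Dxn n y0; have n0 : 0 <
  (n.+1)`!%:R :> R by rewrite ltr0n fact_gt0.
move=> h; rewrite mulrC -ler_pdivrMr//; apply: le_trans h.
by rewrite lerDr.
Qed.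

(** The power [y ^+ k] carries the induction on [P]: a factor ['X] is absorbed by passing from [k]
    to [k.+1]. *)
Lemma poly_expRN_bound P k : exists C : R, forall y, 0 < y ->
  `|y ^+ k * P.[y] * expR (- y)| <= C.
Proof.
elim/poly_ind: P k => [k|P c IH k].
  by exists 0 => y _; rewrite horner0 mulr0 mul0r normr0.
have [C HC] := IH k.+1; exists (C + `|c| * k`!%:R) => y y0.
rewrite !hornerE mulrDr mulrDl (le_trans (ler_normD _ _))// lerD//.
  rewrite (_ : _ * expR _ = y ^+ k.+1 * P.[y] * expR (- y)) ?HC//.
  by rewrite exprS; ring.
rewrite (_ : _ * expR _ = c * (y ^+ k * expR (- y))); last by ring.
rewrite normrM ler_wpM2l// ger0_norm ?exprM_expRN_le1 ?(ltW y0)//.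
by rewrite mulr_ge0 ?expR_ge0 ?exprn_ge0 ?(ltW y0).
Qed.

(** The preceding bound with [k = 1] at [y = x^-1]; it yields the limit at 0. *)
Lemma flat_le P : exists2 C : R, 0 < C & forall x, `|flat P x| <= C * `|x|.
Proof.
have [C HC] := poly_expRN_bound P 1; exists (`|C| + 1) => [|x].
  by rewrite ltr_wpDl.
rewrite /flat; case: ifPn => [x0|_]; last by rewrite normr0 mulr_ge0 ?addr_ge0.
have xV0 : 0 < x^-1 by rewrite invr_gt0.
have := HC _ xV0; rewrite expr1 -mulrA normrM [`|x^-1|]gtr0_norm//.
rewrite [`|x|]gtr0_norm// -ler_pdivrMr// mulrC => /le_trans; apply.
by rewrite (le_trans (ler_norm _))// lerDl.
Qed.

Lemma flat_cvg0 P : flat P h @[h --> (0 : R)^'] --> 0.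
Proof.
have [C C0 HC] := flat_le P.
apply/cvgrPdist_le => e e0; near=> h.
rewrite sub0r normrN (le_trans (HC _))// mulrC -ler_pdivlMr//.
near: h; apply: dnbhs0_le; exact: divr_gt0.
Unshelve. all: by end_near. Qed.

Lemma is_derive_flat P x :
  is_derive x 1 (flat P) (flat ('X^2 * (P - P^`())) x).
Proof.
have [x0|x0|<-] := ltgtP 0 x.
- have nx : \near x, P.[x^-1] * expR (- x^-1) = flat P x.
    near=> z; rewrite /flat ifT//; near: z; exact: lt_nbhsr.
  apply: (near_eq_is_derive nx).
  have xN0 : x != 0 by rewrite gt_eqF.
  have dV : is_derive x 1 (fun y : R => y^-1) (- x ^- 2).
    by apply: is_derive_eq; [exact:
      (@is_deriveV _ id)|rewrite /= /GRing.scale/= mulr1].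
  have dP : is_derive x 1 (horner P \o (fun y : R =>
    y^-1)) (P^`().[x^-1] * - x ^- 2).
    by apply: is_derive1_comp => //; exact: is_derive_poly.
  have dE : is_derive x 1 (expR \o (fun y : R => -
    y^-1)) (expR (- x^-1) * x ^- 2).
    apply: is_derive1_comp.
    by rewrite -[X in is_derive _ _ _ X]opprK; exact: is_deriveN.
  apply: (is_derive_eq (is_deriveM dP dE)).
  rewrite /flat x0 /GRing.scale/= !hornerE/=; field.
  exact: xN0.
- have nx : \near x, 0 = flat P x.
    near=> z; rewrite /flat ifF//; apply/negbTE; rewrite -leNgt ltW//; near: z.
    exact: lt_nbhsl.
  apply: (near_eq_is_derive nx); rewrite /flat ltNge (ltW x0)/=.
  exact: is_derive_cst.
- have H : h^-1 *: ((flat P \o shift 0) (h *: 1) - flat P 0) @[h --> 0^'] --> 0.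
    (* Since the polynomial is evaluated at 1/h, dividing by h multiplies it by ['X]: the difference
       quotient at 0 is again a flat function. *)
    rewrite (_ : (fun _ => _) = flat ('X * P)); first exact: flat_cvg0.
    apply/funext => h; rewrite /= /flat ltxx subr0 addr0 /GRing.scale/= mulr1.
    by case: ifP => _; rewrite ?mulr0// hornerM hornerX; ring.
  rewrite /flat ltxx; split; first by apply/cvg_ex; exists 0.
  exact/cvg_lim.
Unshelve. all: by end_near. Qed.

Lemma continuous_flat P : continuous (flat P).
Proof.
move=> x; apply: differentiable_continuous; apply/derivable1_diffP.
by case: (is_derive_flat P x).
Qed.

Lemma flat1_ge0 x : 0 <= flat 1 x.
Proof. by rewrite /flat; case: ifP => // _; rewrite hornerC mul1r expR_ge0. Qed.

Lemma flat1_le1 x : flat 1 x <= 1.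
Proof.
rewrite /flat; case: ifP => // x0; rewrite hornerC mul1r -expR0 ler_expR.
by rewrite lerNl oppr0 invr_ge0 ltW.
Qed.

Lemma flat_le0 P x : x <= 0 -> flat P x = 0.
Proof. by rewrite /flat; case: ltP. Qed.

Lemma flat1_cvg1 (u : nat -> R) : u n @[n --> \oo] --> +oo ->
  flat 1 (u n) @[n --> \oo] --> (1 : R).
Proof.
move=> uoo.
have : expR (- (u n)^-1) @[n --> \oo] --> expR (- 0).
  apply: (continuous_cvg _ (@continuous_expR R _)).
  apply: cvgN; apply/gtr0_cvgV0; last exact: uoo.
  by near=> n; near: n; move/cvgryPgt: uoo; exact.
rewrite oppr0 expR0; apply: cvg_trans; apply: near_eq_cvg; near=> n.
rewrite /flat ifT; first by rewrite hornerC mul1r.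
by near: n; move/cvgryPgt: uoo; exact.
Unshelve. all: by end_near. Qed.

End flat_function.

(** * Directional derivatives as one-variable derivatives *)

Section slices.
Context (R : realType) (V : normedModType R).
Implicit Types (f : V -> R) (x v : V) (t df : R).

(** Both sides have the same difference quotient. This gives access to the mean value theorem and
    the fundamental theorem of calculus along a line. *)
Lemma is_derive_slice f x v t df :
  is_derive (t *: v + x) v f df <->
  is_derive t (1 : R) (fun s => f (s *: v + x)) df.
Proof.
set g := fun s : R => f (s *: v + x).
have E : (fun h : R =>
      h^-1 *: ((f \o shift (t *: v + x)) (h *: v) - f (t *: v + x))) =
    (fun h : R => h^-1 *: ((g \o shift t) (h *: (1 : R)) - g t)).
  apply/funext => h; rewrite /= (_ : h *: (1 : R) = h); last exact: mulr1.
  by rewrite /g scalerDl addrA.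
split=> -[]; rewrite /derivable /derive; first by rewrite E; split.
by rewrite -E; split.
Qed.

End slices.

(** * Finite orders of smoothness, and symmetry of second derivatives *)

Section Ck.
Context (R : realType) (N : nat).
Notation E := 'rV[R]_N.
Notation e i := (delta_mx ord0 i : E).
Implicit Types (f g : E -> R) (i : 'I_N) (x : E).

(** Level [k] makes the partial derivatives up to order [k] continuous and, beyond that, derivable
    along the axes; so [Ck 0] already gives meaning to [partial i f], but not its continuity. *)
Fixpoint Ck k f : Prop := [/\ continuous f, forall i x, derivable f x (e i) &
  if k is k'.+1 then forall i, Ck k' (partial i f) else True].

Lemma Ck_continuous k f : Ck k f -> continuous f.
Proof. by case: k => [[]|k []]. Qed.

Lemma Ck_derivable k f i x : Ck k f -> derivable f x (e i).
Proof. by case: k => [[]|k []]. Qed.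

Lemma Ck_partial k f i : Ck k.+1 f -> Ck k (partial i f).
Proof. by move=> [_ _]; apply. Qed.

Lemma CkW k f : Ck k.+1 f -> Ck k f.
Proof. by elim: k f => [f|k IH f] /= [cf df H]; split => // i; exact/IH/H. Qed.

(** Replaces lists of indices by an induction on the order, which suits the product rule. Lists are
    peeled from the right because [foldr] applies their last index first. *)
Lemma smoothP f : smooth f <-> forall k, Ck k f.
Proof.
split=> [sf k|Cf s].
  elim: k f sf => [|k IH] f sf; have [cf df] := sf [::]; split => // i.
  by apply: IH => s; have := sf (rcons s i); rewrite foldr_rcons.
elim/last_ind: s f Cf => [|s i IH] f Cf; first by have [] := Cf 0.
by rewrite foldr_rcons; apply: IH => k; have [_ _] := Cf k.+1; exact.
Qed.

Lemma smooth_partial i f : smooth f -> smooth (partial i f).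
Proof.
by move=> /smoothP sf; apply/smoothP => k; have [_ _] := sf k.+1; exact.
Qed.

Lemma partialM i f g : Ck 0 f -> Ck 0 g ->
  partial i (fun x => f x * g x) =
    fun x => f x * partial i g x + g x * partial i f x.
Proof.
move=> [_ df _] [_ dg _]; apply/funext => x.
exact: (deriveM (df i x) (dg i x)).
Qed.

Lemma partialD i f g : Ck 0 f -> Ck 0 g ->
  partial i (fun x => f x + g x) = fun x => partial i f x + partial i g x.
Proof.
move=> [_ df _] [_ dg _]; apply/funext => x.
exact: (deriveD (df i x) (dg i x)).
Qed.

Lemma Ck0 k f : Ck k f -> Ck 0 f.
Proof. by elim: k => // k IH /CkW. Qed.

Lemma CkD k f g : Ck k f -> Ck k g -> Ck k (fun x => f x + g x).
Proof.
elim: k f g => [|k IH] f g Cf Cg; have C0f := Ck0 Cf; have C0g := Ck0 Cg.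
  have [cf df _] := C0f; have [cg dg _] := C0g.
  split; [move=> x|move=> i x|by []].
    exact: (cvgD (cf x) (cg x)).
  exact: (derivableD (df i x) (dg i x)).
have := IH _ _ (CkW Cf) (CkW Cg) => /Ck0 [c d _]; split => // i.
by rewrite partialD//; apply: IH; exact: Ck_partial.
Qed.

Lemma CkM k f g : Ck k f -> Ck k g -> Ck k (fun x => f x * g x).
Proof.
elim: k f g => [|k IH] f g Cf Cg; have C0f := Ck0 Cf; have C0g := Ck0 Cg.
  have [cf df _] := C0f; have [cg dg _] := C0g.
  split; [move=> x|move=> i x|by []].
    exact: (cvgM (cf x) (cg x)).
  exact: (derivableM (df i x) (dg i x)).
have := IH _ _ (CkW Cf) (CkW Cg) => /Ck0 [c d _]; split => // i.
rewrite partialM//; apply: CkD; apply: IH; do ?exact: Ck_partial; exact: CkW.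
Qed.

Lemma smoothM f g : smooth f -> smooth g -> smooth (fun x => f x * g x).
Proof. by move=> /smoothP sf /smoothP sg; apply/smoothP => k; exact: CkM. Qed.

Lemma partial_support i f (K : set E) : compact K -> (forall x, ~ K x ->
    f x = 0) ->
  forall x, ~ K x -> partial i f x = 0.
Proof.
move=> cK f0 x Kx.
have nx : \near x, (cst 0 : E -> R) x = f x.
  have oK : open (~` K) by apply: closed_openC; apply: compact_closed => //;
    exact: norm_hausdorff.
  have := open_nbhs_nbhs (conj oK Kx); apply: filterS => y Ky /=.
  by rewrite f0.
by rewrite /partial -(near_eq_derive _ nx) derive_cst.
Qed.

Lemma test_function_partial U i f : test_function U f ->
    test_function U (partial i f).
Proof.
move=> [sf [K [cK KU f0]]]; split; first exact: smooth_partial.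
by exists K; split => //; exact: partial_support.
Qed.

Lemma is_derive_flat_coord (P : {poly R}) (a c r : R) (j i : 'I_N) x :
  is_derive x (e i) (fun x => r * flat P (a * x ord0 j + c))
    ((r * a *+ (i == j)) * flat ('X^2 * (P - P^`())) (a * x ord0 j + c)).
Proof.
set df := (X in is_derive _ _ _ X).
have := is_derive_slice (fun x => r * flat P (a * x ord0 j + c)) x (e i) 0 df.
rewrite scale0r add0r => ->.
pose b : R := a *+ (i == j).
have dl : is_derive (0 : R) (1 : R) (fun s : R => b * s + (a * x ord0 j + c)) b.
  have d1 : is_derive (0 : R) (1 : R) (fun s : R => b * s) b.
    have h := is_deriveZ b (is_derive_id (0 : R) (1 : R)).
    have bE : b *: (1 : R) = b by exact: mulr1.
    by rewrite bE in h; exact: h.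
  have := is_deriveD d1 (is_derive_cst (a * x ord0 j + c) (0 : R) (1 : R)).
  by rewrite addr0.
rewrite (_ : (fun _ => _) =
    r \*: (flat P \o (fun s : R => b * s + (a * x ord0 j + c)))); last first.
  apply/funext => s /=; rewrite !mxE eqxx/= eq_sym /b; congr (_ * flat _ _).
  by case: eqP => _ /=; ring.
apply: (is_derive_eq (is_deriveZ r (is_derive1_comp _ dl))).
  exact: is_derive_flat.
rewrite /df /b mulr0 add0r /GRing.scale/=.
by case: eqP => _; rewrite ?mulr1n ?mulr0n; ring.
Qed.

(** The factor [r] absorbs the constants produced by differentiation, so the induction on [k], for
    all [P] and [r], closes. *)
Lemma Ck_flat_coord (P : {poly R}) (a c r : R) (j : 'I_N) k :
  Ck k (fun x => r * flat P (a * x ord0 j + c)).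
Proof.
have cf P' r' : continuous (fun x : E => r' * flat P' (a * x ord0 j + c)).
  move=> x; have cl : continuous (fun x : E => a * x ord0 j + c).
    move=> y; exact: (cvgD (cvgM (cvg_cst a) (@coord_continuous _ _ _ ord0 j y))
      (cvg_cst c)).
  exact: (cvgM (cvg_cst r') (continuous_cvg _ (@continuous_flat R P' _)
    (cl x))).
have df P' r' i x : derivable (fun x : E => r' * flat P' (a * x ord0 j +
  c)) x (e i).
  by case: (is_derive_flat_coord P' a c r' j i x).
elim: k P r => [|k IH] P r; split => // i.
rewrite (_ : partial i _ = fun x => (r * a *+ (i == j)) *
  flat ('X^2 * (P - P^`())) (a * x ord0 j + c)); first exact: IH.
apply/funext => x; rewrite /partial.
by have [_ ->] := is_derive_flat_coord P a c r j i x.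
Qed.

Lemma smooth_flat_coord (P : {poly R}) (a c : R) (j : 'I_N) :
  smooth (fun x : E => flat P (a * x ord0 j + c)).
Proof.
apply/smoothP => k; rewrite (_ : (fun _ => _) =
  fun x => 1 * flat P (a * x ord0 j + c)); first exact: Ck_flat_coord.
by apply/funext => x; rewrite mul1r.
Qed.

Lemma partial_slice f i x t : derivable f (t *: e i + x) (e i) ->
  is_derive t (1 : R) (fun s => f (s *: e i + x)) (partial i f (t *: e i + x)).
Proof. by move=> /derivableP /is_derive_slice. Qed.

Lemma continuous_slice f v x : continuous f ->
  continuous (fun s : R => f (s *: v + x)).
Proof.
move=> cf s.
have cl : s' *: v + x @[s' --> s] --> s *: v + x.
  by apply: cvgD; [apply: cvgZr_tmp; exact: cvg_id|exact: cvg_cst].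
exact: (continuous_cvg _ (cf _) cl).
Qed.

(** The mean value theorem is applied along [e i] to the increment of [f] in direction [e j], then
    along [e j] to [partial i f]. *)
Lemma second_difference f i j x (h : R) : Ck 1 f -> 0 < h ->
  exists s t, [/\ 0 <= s <= h, 0 <= t <= h &
    f (h *: e i + (h *: e j + x)) - f (h *: e i + x) - f (h *: e j + x) + f x =
    h ^+ 2 * partial j (partial i f) (t *: e j + (s *: e i + x))].
Proof.
move=> C1 h0; have [cf df _] := C1; have Ci := Ck_partial i C1.
pose g (s : R) := f (s *: e i + (h *: e j + x)) - f (s *: e i + x).
pose dg (s : R) := partial i f (s *: e i + (h *: e j +
  x)) - partial i f (s *: e i + x).
have g' s : is_derive s (1 : R) g (dg s).
  exact: (is_deriveB (partial_slice (df _ _)) (partial_slice (df _ _))).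
have cg : {within `[0, h], continuous g}.
  by apply: derivable_within_continuous => s _; case: (g' s).
have [s /[!in_itv]/= sh] := MVT_segment (ltW h0) (fun s _ => g' s) cg.
rewrite subr0 /g !scale0r !add0r => Es.
pose k (t : R) := partial i f (t *: e j + (s *: e i + x)).
pose dk (t : R) := partial j (partial i f) (t *: e j + (s *: e i + x)).
have k' t : is_derive t (1 : R) k (dk t).
  exact: (partial_slice (Ck_derivable Ci)).
have ck : {within `[0, h], continuous k}.
  by apply: derivable_within_continuous => t _; case: (k' t).
have [t /[!in_itv]/= th] := MVT_segment (ltW h0) (fun t _ => k' t) ck.
rewrite subr0 /k scale0r add0r => Et.
exists s, t; split => //.
rewrite (_ : _ + f x = f (h *: e i + (h *: e j + x)) - f (h *: e i + x) -
  (f (h *: e j + x) - f x)); last by ring.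
have dgE : dg s = dk t * h by rewrite -Et /dg addrCA.
by rewrite Es dgE /dk; ring.
Qed.

(** Schwarz's theorem: the second difference is symmetric in [i] and [j], so the two mixed
    derivatives coincide at points near [x], and continuity brings them to [x]. *)
Lemma partialC f i j x : Ck 2 f ->
  partial i (partial j f) x = partial j (partial i f) x.
Proof.
move=> C2; have C1 := CkW C2.
have key (a c A B eps : R) : A = B -> `|a - A| < eps / 2 ->
  `|c - B| < eps / 2 ->
    `|a - c| <= eps.
  move=> <-; rewrite !ltr_norml => /andP[? ?] /andP[? ?].
  by rewrite ler_norml; apply/andP; split; lra.
have cij : continuous (partial i (partial j f)).
  by apply: (@Ck_continuous 0); apply: Ck_partial; apply: Ck_partial.
have cji : continuous (partial j (partial i f)).
  by apply: (@Ck_continuous 0); apply: Ck_partial; apply: Ck_partial.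
apply/eqP; rewrite -subr_eq0 -normr_le0; apply/ler_addgt0Pl => eps eps0.
have e2 : 0 < eps / 2 by rewrite divr_gt0.
have near_dist (F : E -> R) : continuous F ->
    nbhs x [set y | `|F x - F y| < eps / 2].
  by move=> cF; have /cvgrPdist_lt := cF x; exact.
have /nbhs_ballP[d1 /= d10 H1] := near_dist _ cij.
have /nbhs_ballP[d2 /= d20 H2] := near_dist _ cji.
(* The intermediate points differ from [x] by up to [h + h] in one coordinate when [i = j]; a
   quarter keeps this strictly below both radii. *)
pose h := Num.min d1 d2 / 4.
have d0 : 0 < Num.min d1 d2 by rewrite lt_min d10.
have h0 : 0 < h by rewrite divr_gt0.
have hd : h + h < Num.min d1 d2 by rewrite /h; lra.
move: hd; rewrite lt_min => /andP[hd1 hd2].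
have near_x d (k l : 'I_N) s t : 0 < d -> h + h < d -> 0 <= s <= h ->
  0 <= t <= h ->
    ball x d (t *: e k + (s *: e l + x)).
  move=> dgt0 hd /andP[s0 sh] /andP[t0 th]; split=> // a c.
  rewrite ord1 !mxE !eqxx/= /ball/=.
  rewrite (_ : _ - _ = - (t * (c == k)%:R + s * (c == l)%:R)) ?normrN;
    last by ring.
  apply: le_lt_trans hd; rewrite (le_trans (ler_normD _ _))// !normrM.
  rewrite (ger0_norm s0) (ger0_norm t0).
  by apply: lerD; case: eqP => _; rewrite ?normr1 ?normr0 ?mulr1 ?mulr0// ltW.
have [s [t [sh th]]] := second_difference i j x C1 h0.
have [s' [t' [sh' th']]] := second_difference j i x C1 h0.
have /= := H1 _ (near_x d1 i j s' t' d10 hd1 sh' th').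
have /= := H2 _ (near_x d2 j i s t d20 hd2 sh th).
set A := partial j _ (_ + _); set B := partial i _ (_ + _) => A1 A2 E2 E1.
have AB : A = B.
  apply: (@mulfI _ (h ^+ 2)); first by rewrite expf_neq0// gt_eqF.
  rewrite -[LHS]E1 -[RHS]E2 [h *: e j + (h *: e i + x)]addrCA; congr (_ + _).
  by rewrite addrAC.
rewrite addr0; exact: (key _ _ _ _ _ (esym AB) A2 A1).
Qed.

End Ck.

(** * Integrability of test functions and algebra of weak derivatives *)

Section test_functions.
Context (R : realType) (N : nat).
Notation E := 'rV[R]_N.
Notation leb := (lebesgue_rV R N).
Implicit Types (f g phi : E -> R) (U : set E).

Lemma bounded_box_sqint U f (C M : R) : measurable U ->
  measurable_fun setT f -> (forall x, `|f x| <= C) ->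
  (forall x, ~ box M x -> f x = 0) -> sqint leb U f.
Proof.
move=> mU mf fC f0.
have mfT A : measurable_fun A f by apply: measurable_funS mf.
apply/(integrable_sqint leb (mfT U)).
apply: (@integrableS _ _ _ _ setT) => //.
have -> : EFin \o (fun x => f x ^+ 2) = (EFin \o (fun x =>
  f x ^+ 2)) \_ (@box R N M).
  apply/funext => x; rewrite patchE; case: ifPn => // /negP xM /=.
  by rewrite f0 ?expr0n// => bx; apply: xM; exact: mem_set.
apply/(integrable_mkcond _ (measurable_box M)).
apply: measurable_bounded_integrable; first exact: measurable_box.
- exact: lebesgue_box_fin.
- exact: measurable_funX.
- exists (C ^+ 2); split; first exact: num_real.
  move=> y Cy x _; apply: le_trans (ltW Cy).
  by rewrite normrX lerXn2r ?nnegrE// (le_trans (normr_ge0 _) (fC x)).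
Qed.

Lemma test_function_bounded U phi : test_function U phi ->
  exists C M : R, (forall x, `|phi x| <= C) /\ (forall x, ~ box M x ->
    phi x = 0).
Proof.
move=> [sphi [K [cK _ f0]]]; have [cf _] := sphi [::]; rewrite /= in cf.
have [M KM] := compact_sub_box cK.
have cfK : compact (phi @` K).
  by apply: continuous_compact => //; exact: continuous_subspaceT.
have [C [_ HC]] := compact_bounded cfK.
(* Boundedness of the image is available only for constants above [C], hence [C + 1]; the maximum
   with 0 covers the points off [K]. *)
exists (Num.max 0 (C + 1)), M; split=> x.
  have [Kx|Kx] := pselect (K x); last by rewrite f0// normr0 le_max lexx.
  rewrite le_max; apply/orP; right.
  by apply: (HC (C + 1)); [rewrite ltrDl|exists x].
by move=> xM; apply: f0 => /KM.
Qed.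

Lemma test_function_measurable U phi : test_function U phi ->
  measurable_fun setT phi.
Proof.
by move=> [sphi _]; apply: continuous_measurable_rV; have [] := sphi [::].
Qed.

Lemma test_function_sqint U V phi : measurable U -> test_function V phi ->
  sqint leb U phi.
Proof.
move=> mU tphi; have [C [M [phiC phi0]]] := test_function_bounded tphi.
exact: bounded_box_sqint (test_function_measurable tphi) phiC phi0.
Qed.

Lemma test_functionM U phi g : smooth g -> test_function U phi ->
  test_function U (fun x => phi x * g x).
Proof.
move=> sg [sphi [K [cK KU phi0]]]; split; first exact: smoothM.
by exists K; split=> // x Kx; rewrite phi0// mul0r.
Qed.

(** Equality as distributions on [U], the sense in which two weak derivatives of one function
    agree. *)
Definition weq U (w w' : E -> R) :=
  forall phi, test_function U phi -> dot leb U w phi = dot leb U w' phi.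

Lemma is_wderiv_has U i u w : is_wderiv U i u w -> has_wderiv U i u.
Proof. by move=> h; apply: xgetPex; exists w. Qed.

Lemma is_wderiv_weq U i u w w' : is_wderiv U i u w -> is_wderiv U i u w' ->
  weq U w w'.
Proof.
move=> [_ h] [_ h'] phi tphi; apply: oppr_inj.
by rewrite -[LHS]h// -[RHS]h'.
Qed.

Lemma is_wderivD U i u w u' w' : measurable U -> L2 U u -> L2 U u' ->
  is_wderiv U i u w -> is_wderiv U i u' w' ->
  is_wderiv U i (fun x => u x + u' x) (fun x => w x + w' x).
Proof.
move=> mU su su' [sw h] [sw' h']; split; first exact: sqintD.
move=> phi tphi; have sphi := test_function_sqint mU tphi.
have spphi := test_function_sqint mU (test_function_partial i tphi).
rewrite -!/(dot _ _ _ _) !dotDl// opprD.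
by congr (_ + _); [exact: h|exact: h'].
Qed.

Lemma is_wderivZ U i c u w : measurable U -> L2 U u ->
  is_wderiv U i u w -> is_wderiv U i (fun x => c * u x) (fun x => c * w x).
Proof.
move=> mU su [sw h]; split; first exact: sqintZ.
move=> phi tphi; have sphi := test_function_sqint mU tphi.
have spphi := test_function_sqint mU (test_function_partial i tphi).
rewrite -!/(dot _ _ _ _) !dotZl// -mulrN; congr (_ * _); exact: h.
Qed.

End test_functions.

(** * Vertical cutoffs inside the slab *)

Section cutoff.
Context (R : realType) (d : nat) (b : R).
Notation E := 'rV[R]_d.+1.
Notation leb := (lebesgue_rV R d.+1).
Notation O := (@slab R d b).

Lemma measurable_slab : measurable O.
Proof.
rewrite (_ : O = (fun x : E => x ord0 ord_max) @^-1` `]0, b[%classic).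
  by rewrite -[X in measurable X]setTI; apply: measurable_coord => //;
    exact: measurable_itv.
by apply/seteqP; split => x; rewrite /= in_itv.
Qed.

(* Supported in 1/(k+1) <= x_n <= b - 1/(k+1); its limit is 1 because
   [flat 1 y] tends to 1 as y tends to +oo. *)
Definition cutoff (k : nat) (x : E) : R :=
  flat 1 (k.+1%:R * x ord0 ord_max + -1) *
  flat 1 (- k.+1%:R * x ord0 ord_max + (k.+1%:R * b - 1)).

Lemma smooth_cutoff k : smooth (cutoff k).
Proof. by apply: smoothM; exact: smooth_flat_coord. Qed.

Lemma cutoff_ge0 k x : 0 <= cutoff k x.
Proof. by rewrite mulr_ge0 ?flat1_ge0. Qed.

Lemma cutoff_le1 k x : cutoff k x <= 1.
Proof. by rewrite mulr_ile1 ?flat1_ge0 ?flat1_le1. Qed.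

Lemma cutoff_cvg1 x : O x -> cutoff k x @[k --> \oo] --> (1 : R).
Proof.
move=> /andP[x0 xb]; rewrite -[X in _ --> X](mulr1 1).
have lin (a c : R) : 0 < a -> k.+1%:R * a + c @[k --> \oo] --> +oo.
  move=> a0; apply/cvgryPge => A; near=> k.
  rewrite -lerBlDr -ler_pdivrMr//; apply: (@le_trans _ _ k%:R);
    last by rewrite ler_nat.
  by near: k; exact: nbhs_infty_ger.
apply: cvgM; apply: flat1_cvg1; first exact: lin.
rewrite (_ : (fun n => _) = fun k : nat => k.+1%:R * (b - x ord0 ord_max) + -1).
  by apply: lin; rewrite subr_gt0.
by apply/funext => k; ring.
Unshelve. all: by end_near. Qed.

Lemma partial_cutoff i k x : i != ord_max -> partial i (cutoff k) x = 0.
Proof.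
move=> imax; rewrite /cutoff.
have E1 (a c : R) : (fun x : E => flat 1 (a * x ord0 ord_max + c)) =
    fun x => 1 * flat 1 (a * x ord0 ord_max + c).
  by apply/funext => y; rewrite mul1r.
have p0 (a c : R) y : partial i (fun x : E => flat 1 (a * x ord0 ord_max +
  c)) y = 0.
  rewrite E1 /partial; have [_ ->] := is_derive_flat_coord 1 a c 1 ord_max i y.
  by rewrite (negbTE imax) mulr0n mul0r.
have C0 (a c : R) : Ck 0 (fun x : E => flat 1 (a * x ord0 ord_max + c)).
  by rewrite E1; exact: Ck_flat_coord.
by rewrite partialM// !p0 !mulr0 addr0.
Qed.

Lemma test_function_cutoff k phi : test_function setT phi ->
  test_function O (fun x => phi x * cutoff k x).
Proof.
move=> tphi; have [s _] := test_functionM (smooth_cutoff k) tphi; split;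
  first exact: s.
have [_ [K [cK _ phi0]]] := tphi.
pose F := [set x : E | k.+1%:R^-1 <= x ord0 ord_max] `&`
          [set x : E | x ord0 ord_max <= b - k.+1%:R^-1].
have k0 : 0 < k.+1%:R^-1 :> R by rewrite invr_gt0.
exists (K `&` F); split.
- have cc : continuous (fun x : E => x ord0 ord_max) := @coord_continuous _ _ _
  _ _.
  apply: compact_closedI => //; apply: closedI.
    exact: (preimage_closed (fun x _ => cc x) (@closed_ge _ _)).
  exact: (preimage_closed (fun x _ => cc x) (@closed_le _ _)).
- move=> x [_ [/= h1 h2]]; rewrite /slab/= (lt_le_trans k0 h1)/=.
  by rewrite (le_lt_trans h2)// ltrBlDr ltrDl.
- move=> x /not_andP[Kx|/not_andP[/negP|/negP]]; first by rewrite phi0// mul0r.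
    rewrite /= -ltNge => h; rewrite /cutoff flat_le0 ?mul0r ?mulr0//.
    by rewrite subr_le0 mulrC -ler_pdivlMr// mul1r ltW.
  rewrite /= -ltNge => h; rewrite /cutoff [X in _ * (_ * X)]flat_le0 ?mulr0//.
  have -> : - k.+1%:R * x ord0 ord_max + (k.+1%:R * b - 1) =
      k.+1%:R * (b - x ord0 ord_max) - 1 by ring.
  by rewrite subr_le0 mulrC -ler_pdivlMr// mul1r lerBlDl -lerBlDr ltW.
Qed.

(** Dominated convergence, with [g ^+ 2] as the bound because the cutoff lies between 0 and 1. *)
Lemma cutoff_cvg g : sqint leb O g ->
  cvg_sqint leb O (fun k x => g x * cutoff k x) g.
Proof.
move=> sg; have mO := measurable_slab; have mg := sg.1.
have mc k : measurable_fun O (cutoff k).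
  apply: measurable_funS (continuous_measurable_rV _) => //.
  by have [] := smooth_cutoff k [::].
have ig2 : leb.-integrable O (EFin \o
  (fun x => g x ^+ 2)) by apply/(integrable_sqint leb mg).
have mf k : measurable_fun O (fun x => ((g x * cutoff k x - g x) ^+ 2)%:E).
  by apply/measurable_EFinP/measurable_funX/measurable_funB => //;
    exact: measurable_funM.
have [] := dominated_convergence mO mf (measurable_cst 0%E) _ ig2 _.
- apply: aeW => x Ox; apply/cvg_EFin; first by near=> k.
  have h : g x * cutoff k x - g x @[k --> \oo] --> (0 : R).
    rewrite [X in _ --> X](_ : 0 = g x * 1 - g x); last by rewrite mulr1 subrr.
    exact: (cvgB (cvgM (cvg_cst _) (cutoff_cvg1 Ox)) (cvg_cst _)).
  by have := cvgM h h; rewrite mulr0; exact.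
- apply: aeW => x k Ox; rewrite lee_fin ger0_norm ?sqr_ge0//.
  rewrite -[X in _ - X]mulr1 -mulrBr exprMn ler_piMr ?sqr_ge0//.
  by have := cutoff_ge0 k x; have := cutoff_le1 k x; nra.
- by move=> _ _; rewrite integral0.
Unshelve. all: by end_near. Qed.

End cutoff.

(** * Tangential integration by parts *)

Section slab_integration_by_parts.
Context (R : realType) (d : nat) (b : R).
Notation E := 'rV[R]_d.+1.
Notation leb := (lebesgue_rV R d.+1).
Notation O := (@slab R d b).
Notation sq := (sqint leb O).
Notation D := (wderiv O).
Notation ip := (dot leb O).
Implicit Types (u v w V S : E -> R) (z : nat -> E -> R).

Let mO := @measurable_slab R d b.

(** The part of [has_trace] that does not mention the boundary: [V] is an H^1 limit of restrictions
    of test functions of the whole space. *)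
Definition approx z V := [/\ forall m, test_function setT (z m),
  sq V, forall i, has_wderiv O i V,
  cvg_sqint leb O z V &
  forall i, cvg_sqint leb O (fun m => partial i (z m)) (D i V)].

Lemma approx_sqint z V m : approx z V -> sq (z m).
Proof. by move=> [tz _ _ _ _]; exact: test_function_sqint (tz m). Qed.

Lemma approx_sqint_partial z V m i : approx z V -> sq (partial i (z m)).
Proof.
by move=> [tz _ _ _ _]; exact: test_function_sqint (test_function_partial i
  (tz m)).
Qed.

Lemma approx_cvg z V w : approx z V -> sq w ->
  ip w (z m) @[m --> \oo] --> ip w V.
Proof.
move=> az sw; have [_ sV _ cV _] := az.
have sz m : sq (z m) by exact: approx_sqint az.
exact: (cvg_dot mO (F := fun=> w)
  (fun=> sw) sw sz sV (cvg_sqint_cst leb O w) cV).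
Qed.

Lemma approx_cvg_partial z V w i : approx z V -> sq w ->
  ip w (partial i (z m)) @[m --> \oo] --> ip w (D i V).
Proof.
move=> az sw; have [_ _ dV _ cV] := az.
have sz m : sq (partial i (z m)) by exact: approx_sqint_partial az.
exact: (cvg_dot mO (F := fun=> w)
  (fun=> sw) sw sz (dV i).1 (cvg_sqint_cst leb O w)
  (cV i)).
Qed.

Lemma test_cutoff_cvg f w : sq f -> sq w ->
  ip w (fun x => f x * cutoff b k x) @[k --> \oo] --> ip w f.
Proof.
move=> sf sw.
have sfc k : sq (fun x => f x * cutoff b k x).
  have mc : measurable_fun O (cutoff b k : E -> R).
    apply: measurable_funS (continuous_measurable_rV _) => //.
    by have [] := @smooth_cutoff R d b k [::].
  rewrite (_ : (fun x => _) = fun x => cutoff b k x * f x); last first.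
    by apply/funext => x; rewrite mulrC.
  apply: (sqint_bounded_mul mO (M := 1)) => // x _.
  by rewrite ger0_norm ?cutoff_ge0 ?cutoff_le1.
exact: (cvg_dot mO (F := fun=> w) (fun=> sw) sw sfc sf (cvg_sqint_cst leb O w)
  (cutoff_cvg sf)).
Qed.

(** Extends equality as distributions from test functions of the slab to such a limit [V]: at fixed
    [m] the cutoff is removed by letting it tend to 1, and then [m] tends to infinity. *)
Lemma weq_dot z V w w' : sq w -> sq w' -> weq O w w' -> approx z V ->
  ip w V = ip w' V.
Proof.
move=> sw sw' ww' az; have [tz _ _ _ _] := az.
have E1 m : ip w (z m) = ip w' (z m).
  have sz := approx_sqint m az.
  have c1 := test_cutoff_cvg sz sw; have c2 := test_cutoff_cvg sz sw'.
  apply: (cvg_seq_unique c1); rewrite (_ : (fun k => _) = (fun k =>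
    ip w' (fun x => z m x * cutoff b k x))); first exact: c2.
  by apply/funext => k; exact: (ww' _ (test_function_cutoff _ _ (tz m))).
have c1 := approx_cvg az sw; have c2 := approx_cvg az sw'.
apply: (cvg_seq_unique c1); rewrite (_ : (fun k => _) = (fun k => ip w' (z k))).
  exact: c2.
by apply/funext => m; exact: E1.
Qed.

(** For [z m] times a cutoff this is the definition of the weak derivative, and [partial i] does not
    see the cutoff, which depends on x_n only. The same two limits as in [weq_dot] follow. *)
Lemma ibp_tangential z V S i : i != ord_max -> sq S -> has_wderiv O i S ->
  approx z V -> ip (D i S) V = - ip S (D i V).
Proof.
move=> imax sS [sDS hDS] az; have [tz _ _ _ _] := az.
have E1 m : ip (D i S) (z m) = - ip S (partial i (z m)).
  have sz := approx_sqint m az; have spz := approx_sqint_partial m i az.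
  have c1 := test_cutoff_cvg sz sDS; have c2 := cvgN (test_cutoff_cvg spz sS).
  apply: (cvg_seq_unique c1); rewrite (_ : (fun k => _) = (fun k =>
    - ip S (fun x => partial i (z m) x * cutoff b k x))); first exact: c2.
  apply/funext => k; have tzk := test_function_cutoff b k (tz m).
  have [/smoothP sz' _] := tz m; have /smoothP sc := @smooth_cutoff R d b k.
  apply: oppr_inj; rewrite opprK -[LHS]hDS//; apply: eq_Rintegral => x _.
  rewrite partialM; [|exact: sz'|exact: sc].
  by rewrite partial_cutoff// mulr0 add0r [in RHS](mulrC (partial _ _ _)).
have c1 := approx_cvg az sDS; have c2 := cvgN (approx_cvg_partial
  (i := i) az sS).
apply: (cvg_seq_unique c1); rewrite (_ : (fun k => _) = (fun k =>
  - ip S (partial i (z k)))); first exact: c2.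
by apply/funext => m; exact: E1.
Qed.

(** Both derivatives are moved onto the test function, where they commute by [partialC]. *)
Lemma weq_mixed u i j : has_wderiv O i u -> has_wderiv O j u ->
  has_wderiv O i (D j u) -> has_wderiv O j (D i u) ->
  weq O (D i (D j u)) (D j (D i u)).
Proof.
move=> [_ hi] [_ hj] [_ hij] [_ hji] phi tphi.
have E1 : ip (D j u) (partial i phi) = - ip (D i (D j u)) phi := hij _ tphi.
have E2 : ip (D i u) (partial j phi) = - ip (D j (D i u)) phi := hji _ tphi.
have E3 : ip u (partial j (partial i phi)) = - ip (D j u) (partial i phi) :=
  hj _ (test_function_partial i tphi).
have E4 : ip u (partial i (partial j phi)) = - ip (D i u) (partial j phi) :=
  hi _ (test_function_partial j tphi).
have C : partial j (partial i phi) = partial i (partial j phi).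
  by have [/smoothP sphi _] := tphi; apply/funext => x; exact: partialC.
have E5 := oppr_inj (etrans (esym E3) (etrans (congr1 (ip u) C) E4)).
exact: (oppr_inj (etrans (esym E1) (etrans E5 E2))).
Qed.

Lemma has_trace_approx c V (w : 'rV[R]_d -> R) : has_trace b c V w -> exists z,
  [/\ approx z V, L2 setT w & cvgL2 setT (fun m x => z m (snoc x c)) w].
Proof.
move=> [+ sw [z [tz cz cDz ctr]]]; rewrite /sobolev truncn1 => -[sV hV].
by exists z; split => //; split => // i; have [] := hV i.
Qed.

End slab_integration_by_parts.

(** * Traces and the normal Green formula *)

Section slab_fubini.
Local Open Scope ereal_scope.
Context (R : realType) (d : nat) (b : R).
Notation E := 'rV[R]_d.+1.
Notation leb := (lebesgue_rV R d.+1).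
Notation lebd := (lebesgue_rV R d).
Notation leb1 := (@lebesgue_measure R).
Notation O := (@slab R d b).
Notation I := `]0%R, b[%classic.

Let mO := @measurable_slab R d b.
Let m2 : {sigma_finite_measure set (measurableTypeR R) -> \bar R} := leb1.

Lemma snoc_slab x t : O (snoc x t) = I t.
Proof. by rewrite /slab /snoc/= mxE unlift_none in_itv. Qed.

Lemma restrict_slab_snoc (f : E -> \bar R) x :
  (fun t => (f \_ O) (snoc x t)) = (fun t => f (snoc x t)) \_ I.
Proof.
apply/funext => t; rewrite !patchE.
suff -> : (snoc x t \in O) = (t \in I) by [].
by apply/idP/idP; rewrite !inE snoc_slab.
Qed.

Lemma fubini_F_slab (f : E -> \bar R) :
  fubini_F m2 ((f \_ O) \o @snoc_pair R d) =
  fun x => \int[leb1]_(t in I) f (snoc x t).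
Proof.
apply/funext => x; rewrite /fubini_F [RHS]integral_mkcond -restrict_slab_snoc.
by [].
Qed.

Lemma measurable_snoc_restrict (f : E -> \bar R) : measurable_fun O f ->
  measurable_fun setT ((f \_ O) \o @snoc_pair R d).
Proof.
move=> mf; apply: measurableT_comp; last exact: measurable_snoc_pair.
exact/(measurable_restrictT _ mO).
Qed.

Lemma measurable_slice (f : E -> R) x : measurable_fun O f ->
  measurable_fun I (fun t => f (snoc x t)).
Proof.
move=> mf; apply/(measurable_restrictT _ (measurable_itv _)).
have -> : (fun t => f (snoc x t)) \_ I = ((f \_ O) \o @snoc_pair R d) \o pair x.
  apply/funext => t; rewrite /= !patchE.
  suff -> : (snoc_pair (x, t) \in O) = (t \in I) by [].
  by apply/idP/idP; rewrite !inE /snoc_pair snoc_slab.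
apply: measurableT_comp; last exact: pair1_measurable.
apply: measurableT_comp; last exact: measurable_snoc_pair.
exact/(measurable_restrictT _ mO).
Qed.

(** [lebesgue_rV] in dimension d + 1 is the image of a product measure under [snoc_pair], so
    Tonelli's theorem is applied to the extension of [f] by zero. *)
Lemma slab_tonelli (f : E -> \bar R) : measurable_fun O f ->
  (forall x, O x -> 0 <= f x) ->
  \int[leb]_(x in O) f x = \int[lebd]_x \int[leb1]_(t in I) f (snoc x t).
Proof.
move=> mf f0; rewrite integral_mkcond.
have g0 x : 0 <= (f \_ O) x.
  by rewrite patchE; case: ifPn => // /set_mem; exact: f0.
rewrite [LHS](@ge0_integral_pushforward _ _ _ _ _ _
  (@measurable_snoc_pair R d) (lebd \x m2) setT)//.
- rewrite preimage_setT -fubini_F_slab; apply: fubini_tonelli1.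
    exact: measurable_snoc_restrict.
  by move=> z; exact: g0.
- exact/(measurable_restrictT _ mO).
Qed.

Lemma measurable_slab_tonelli (f : E -> \bar R) : measurable_fun O f ->
  (forall x, O x -> 0 <= f x) ->
  measurable_fun setT (fun x => \int[leb1]_(t in I) f (snoc x t)).
Proof.
move=> mf f0; rewrite -fubini_F_slab; apply: measurable_fun_fubini_tonelli_F.
  exact: measurable_snoc_restrict.
by move=> z /=; rewrite patchE; case: ifPn => // /set_mem; exact: f0.
Qed.

Lemma slab_integrable_prod (f : E -> \bar R) : leb.-integrable O f ->
  (lebd \x m2).-integrable setT ((f \_ O) \o @snoc_pair R d).
Proof.
move=> intf; have mf := measurable_int _ intf; apply/integrableP; split.
  exact: measurable_snoc_restrict.
have /integrableP[_] := intf; rewrite integral_mkcond.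
rewrite [X in X < _](@ge0_integral_pushforward _ _ _ _ _ _
  (@measurable_snoc_pair R d) (lebd \x m2) setT)//.
- rewrite preimage_setT; apply: le_lt_trans; rewrite le_eqVlt; apply/orP; left.
  apply/eqP/eq_integral => z _ /=; rewrite !patchE; case: ifPn => //.
  by rewrite abse0.
- apply/(measurable_restrictT _ mO); exact: measurableT_comp.
- by move=> x _; rewrite patchE; case: ifPn.
Qed.

Lemma slab_fubini (f : E -> \bar R) : leb.-integrable O f ->
  \int[leb]_(x in O) f x = \int[lebd]_x \int[leb1]_(t in I) f (snoc x t).
Proof.
move=> intf; have intp := slab_integrable_prod intf.
have mf := measurable_int _ intf.
rewrite -fubini_F_slab integral12_prod_meas1// integral_mkcond.
rewrite [LHS](@integral_pushforward _ _ _ _ _ _ (@measurable_snoc_pair R d)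
  (lebd \x m2) setT)//.
exact/(measurable_restrictT _ mO).
Qed.

End slab_fubini.

(** * Square-integrability of integrals over vertical fibres *)

Section normal_traces.
Context (R : realType) (d : nat) (b : R).
Hypothesis b_gt0 : 0 < b.
Notation E := 'rV[R]_d.+1.
Notation leb := (lebesgue_rV R d.+1).
Notation lebd := (lebesgue_rV R d).
Notation leb1 := (@lebesgue_measure R).
Notation O := (@slab R d b).
Notation I := `]0%R, b[%classic.
Notation en := (delta_mx ord0 ord_max : E).
Notation sq := (sqint leb O).
Notation D := (wderiv O).
Implicit Types (f g h : E -> R).

Let mO := @measurable_slab R d b.
Let mI : measurable (I : set (measurableTypeR R)) := measurable_itv _.

Definition fiber_int h (x : 'rV[R]_d) : R := \int[leb1]_(t in I) h (snoc x t).

(** [h] need not be integrable on every fibre, so measurability is obtained from the positive and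
    negative parts separately; [fine] gives 0 wherever their difference is infinite. *)
Lemma measurable_fiber_int h : measurable_fun O h ->
  measurable_fun setT (fiber_int h).
Proof.
move=> mh; have mEh : measurable_fun O (EFin \o h) by exact/measurable_EFinP.
have mp := measurable_slab_tonelli (measurable_funepos mEh) (fun x _ =>
  funepos_ge0 _ x).
have mn := measurable_slab_tonelli (measurable_funeneg mEh) (fun x _ =>
  funeneg_ge0 _ x).
rewrite (_ : fiber_int h = fine \o (fun x =>
    (\int[leb1]_(t in I) ((EFin \o h)^\+ (snoc x t)) -
     \int[leb1]_(t in I) ((EFin \o h)^\- (snoc x t)))%E)).
  by apply: measurableT_comp => //; exact: emeasurable_funB.
apply/funext => x; rewrite /fiber_int /Rintegral /= integralE.  congr (fine _).
by congr (_ - _)%E; apply: eq_integral => t _; rewrite ?funeposE ?funenegE.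
Qed.

Lemma sqint_cst1 : sqint leb1 I (fun=> 1).
Proof.
split; first exact: measurable_cst.
under eq_integral do rewrite expr1n.
by rewrite integral_cst//= lebesgue_measure_itv/=; case: ifP;
  rewrite ?mule0 ?mul1e ltry.
Qed.

Lemma dot_cst1 : dot leb1 I (fun=> 1) (fun=> 1) = b.
Proof.
rewrite /dot; under eq_Rintegral do rewrite mulr1.
rewrite Rintegral_cst//= lebesgue_measure_itv/= lte_fin b_gt0.
by rewrite oppr0 adde0 mul1r.
Qed.

(** Cauchy-Schwarz against the constant 1, whose squared norm on the fibre is [b]. A fibre with
    infinite right-hand side is trivial. *)
Lemma fiber_int_le h x : measurable_fun O h ->
  (((fiber_int h x) ^+ 2)%:E <=
    b%:E * \int[leb1]_(t in I) ((h (snoc x t)) ^+ 2)%:E)%E.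
Proof.
move=> mh; have [foo|] := boolP (\int[leb1]_(t in I)
  ((h (snoc x t)) ^+ 2)%:E < +oo)%E;
  last first.
  by rewrite -leNgt leye_eq => /eqP ->; rewrite gt0_muley ?lte_fin// leey.
have sh : sqint leb1 I (fun t => h (snoc x t)).
  by split => //; exact: measurable_slice.
have ih : (\int[leb1]_(t in I) ((h (snoc x t)) ^+ 2)%:E =
    (dot leb1 I (fun t => h (snoc x t)) (fun t => h (snoc x t)))%:E)%E.
  by rewrite /dot /Rintegral fineK//; apply: integrable_fin_num => //;
    exact: sqint_mul.
have /= := cauchy_schwarz mI sh sqint_cst1.
rewrite dot_cst1 ih -EFinM lee_fin.
rewrite (_ : dot leb1 I _ (fun=> 1) = fiber_int h x); last first.
  by apply: eq_Rintegral => t _; rewrite mulr1.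
move=> hs; rewrite -real_normK ?num_real//.
rewrite (le_trans (lerXn2r 2 _ _ hs)) ?nnegrE ?mulr_ge0 ?sqrtr_ge0//.
by rewrite exprMn !sqr_sqrtr ?dot_ge0 ?(ltW b_gt0)// mulrC.
Qed.

Lemma measurable_sqr_EFin h : measurable_fun O h ->
  measurable_fun O (fun x => ((h x) ^+ 2)%:E).
Proof. by move=> mh; apply/measurable_EFinP; exact: measurable_funX. Qed.

Lemma sqr_fiber_int_le h : measurable_fun O h ->
  (\int[lebd]_x ((fiber_int h x) ^+ 2)%:E <=
    b%:E * \int[leb]_(x in O) ((h x) ^+ 2)%:E)%E.
Proof.
move=> mh; have mh2 := measurable_sqr_EFin mh.
have h20 x : O x -> (0 <= ((h x) ^+ 2)%:E)%E by rewrite lee_fin sqr_ge0.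
have mF := measurable_slab_tonelli mh2 h20.
have F0 x : (0 <= \int[leb1]_(t in I) ((h (snoc x t)) ^+ 2)%:E)%E.
  by apply: integral_ge0 => t _; rewrite lee_fin sqr_ge0.
rewrite (slab_tonelli mh2 h20) -ge0_integralZl//; last by rewrite lee_fin ltW.
apply: ge0_le_integral => //.
- by move=> x _; rewrite lee_fin sqr_ge0.
- by apply/measurable_EFinP/measurable_funX; exact: measurable_fiber_int.
- by apply: emeasurable_funM.
- by move=> x _; exact: fiber_int_le.
Qed.

Lemma sqint_fiber_int h : sq h -> sqint lebd setT (fiber_int h).
Proof.
move=> [mh hoo]; split; first exact: measurable_fiber_int.
apply: le_lt_trans (sqr_fiber_int_le mh) _.
by rewrite lte_mul_pinfty ?lee_fin ?(ltW b_gt0).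
Qed.

(** By Tonelli the fibre integrals of the square of [h] have a finite integral, hence are finite
    almost everywhere. *)
Lemma fiber_sqint_ae h : sq h ->
  {ae lebd, forall x, sqint leb1 I (fun t => h (snoc x t))}.
Proof.
move=> [mh hoo]; have mh2 := measurable_sqr_EFin mh.
have h20 x : O x -> (0 <= ((h x) ^+ 2)%:E)%E by rewrite lee_fin sqr_ge0.
have : lebd.-integrable setT (fun x => \int[leb1]_(t in I)
  ((h (snoc x t)) ^+ 2)%:E)%E.
  apply/integrableP; split; first exact: (measurable_slab_tonelli mh2 h20).
  move: hoo; rewrite (slab_tonelli mh2 h20); apply: le_lt_trans.
  rewrite le_eqVlt; apply/orP; left; apply/eqP/eq_integral => x _.
  by rewrite gee0_abs//; apply: integral_ge0 => t _; rewrite lee_fin sqr_ge0.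
move=> /(integrable_ae measurableT); apply: filterS => x /= /(_ Logic.I) xfin.
split; first exact: measurable_slice.
rewrite -ge0_fin_numE; first exact: xfin.
by apply: integral_ge0 => t _; rewrite lee_fin sqr_ge0.
Qed.

(** Additivity is available on the fibres where both functions are square integrable, which are
    almost all of them. *)
Lemma fiber_intB_ae f h : sq f -> sq h ->
  {ae lebd, forall x, fiber_int (fun y => f y - h y) x =
    fiber_int f x - fiber_int h x}.
Proof.
move=> /fiber_sqint_ae sf /fiber_sqint_ae sh; apply: filterS2 sf sh => x sf sh.
have i1 s : sqint leb1 I s -> leb1.-integrable I (EFin \o s).
  move=> ss; have := sqint_mul mI ss sqint_cst1.
  by rewrite (_ : (fun x => s x * 1) = s)//; apply/funext => t; rewrite mulr1.
by rewrite /fiber_int RintegralB//; exact: i1.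
Qed.

Lemma cvg_fiber_int (F : nat -> E -> R) f : (forall m, sq (F m)) -> sq f ->
  cvg_sqint leb O F f ->
  cvg_sqint lebd setT (fun m => fiber_int (F m)) (fiber_int f).
Proof.
move=> sF sf cF.
have c0 : (b%:E * \int[leb]_(x in O) ((F m x -
  f x) ^+ 2)%:E)%E @[m --> \oo] --> 0%E.
  by rewrite -(mule0 b%:E); apply: cvgeZl => //.
apply: (@squeeze_cvge _ _ _ _ (fun=> 0%E) _ (fun m =>
  (b%:E * \int[leb]_(x in O) ((F m x - f x) ^+ 2)%:E)%E)); last 2 first.
- exact: cvg_cst.
- exact: c0.
near=> m; apply/andP; split; first by apply: integral_ge0 => x _;
  rewrite lee_fin sqr_ge0.
have mFf : measurable_fun O (fun x => F m x - f x) := (sqintB mO (sF m) sf).1.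
apply: le_trans (sqr_fiber_int_le mFf); rewrite le_eqVlt; apply/orP; left;
  apply/eqP.
apply: ae_eq_integral => //.
- apply/measurable_EFinP/measurable_funX/measurable_funB;
  apply: measurable_fiber_int.
    by case: (sF m).
  by case: sf.
- by apply/measurable_EFinP/measurable_funX; exact: measurable_fiber_int.
- by apply: filterS (fiber_intB_ae (sF m) sf) => x /= -> _.
Unshelve. all: by end_near. Qed.

End normal_traces.

(** * Traces as fibre integrals, and Green's formula in the normal direction *)

Section green.
Context (R : realType) (d : nat) (b : R).
Hypothesis b_gt0 : 0 < b.
Notation E := 'rV[R]_d.+1.
Notation leb := (lebesgue_rV R d.+1).
Notation lebd := (lebesgue_rV R d).
Notation leb1 := (@lebesgue_measure R).
Notation O := (@slab R d b).
Notation I := `]0%R, b[%classic.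
Notation n := (@ord_max d).
Notation en := (delta_mx ord0 n : E).
Notation sq := (sqint leb O).
Notation D := (wderiv O).
Implicit Types (f g h V A : E -> R) (z : nat -> E -> R).

Let mO := @measurable_slab R d b.

Lemma snocE (x : 'rV[R]_d) t : snoc x t = t *: en + snoc x 0.
Proof.
apply/rowP => j; rewrite !mxE eqxx/=; case: unliftP => [i ->|->].
  by rewrite eq_sym (negbTE (neq_lift _ _)) mulr0 add0r.
by rewrite eqxx mulr1 addr0.
Qed.

Lemma fiber_FTC f x : Ck 0 f -> continuous (partial n f) ->
  (\int[leb1]_(t in I) (partial n f (snoc x t))%:E =
   (f (snoc x b) - f (snoc x 0))%:E)%E.
Proof.
move=> [cf df _] cdf.
pose F t := f (t *: en + snoc x 0);
  pose F' t := partial n f (t *: en + snoc x 0).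
have cF : continuous F by exact: continuous_slice.
have cF' : continuous F' by exact: continuous_slice.
have dF t : is_derive t (1 : R) F (F' t) by exact: partial_slice.
transitivity (\int[leb1]_(t in `[0%R, b]) (F' t)%:E)%E.
  rewrite [RHS](integral_itv_bndoo true false); last first.
    apply/measurable_EFinP; apply: measurable_funS
      (continuous_measurable_fun cF') => //.
  by apply: eq_integral => t _; rewrite snocE.
rewrite (continuous_FTC2 (F := F)) //.
- by rewrite /F -!snocE -EFinB.
- exact: continuous_subspaceT.
- split; first by move=> t _; case: (dF t).
    exact: cvg_at_right_filter (cF 0).
  exact: cvg_at_left_filter (cF b).
- by move=> t _; rewrite derive1E; have [_ ->] := dF t.
Qed.

Lemma is_derive_coord (r s : R) (i j : 'I_d.+1) x :
  is_derive x (delta_mx ord0 i) (fun y : E => r * y ord0 j + s) (r *+ (i == j)).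
Proof.
have := is_derive_slice (fun y : E => r * y ord0 j +
  s) x (delta_mx ord0 i) 0 (r *+ (i == j)).
rewrite scale0r add0r => ->.
have h := is_deriveZ (r *+ (i == j)) (is_derive_id (0 : R) (1 : R)).
have bE : (r *+ (i == j)) *: (1 : R) = r *+ (i == j) by exact: mulr1.
rewrite bE in h.
have := is_deriveD h (is_derive_cst (r * x ord0 j + s) (0 : R) (1 : R)).
rewrite addr0; set F := (X in is_derive _ _ X _).
have -> // : F = fun t : R => r * (t *: delta_mx ord0 i + x : E) ord0 j + s.
apply/funext => t; rewrite /F /= !mxE eqxx/= [j == i]eq_sym.
transitivity ((r *+ (i == j)) * t + (r * x ord0 j + s)); first by [].
by case: eqP => _ /=; ring.
Qed.

Lemma test_trace_sqint phi (c : R) : test_function setT phi ->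
  sqint lebd setT (fun x => phi (snoc x c)).
Proof.
move=> tphi; have [C [M [phiC phi0]]] := test_function_bounded tphi.
apply: (bounded_box_sqint (C := C) (M := M)) => //.
  apply: (measurableT_comp (test_function_measurable tphi)).
  rewrite (_ : (fun x => _) = @snoc_pair R d \o (fun x => (x, c)))//.
  apply: (measurableT_comp (@measurable_snoc_pair R d)).
  exact: measurable_fun_pair.
move=> x xM; apply: phi0 => bx; apply: xM => j.
by have := bx (lift ord_max j); rewrite mxE liftK.
Qed.

(** The product rule, Fubini, and the fundamental theorem of calculus on each fibre. *)
Lemma green_test phi zeta : test_function setT phi -> test_function setT zeta ->
  dot leb O (partial n phi) zeta + dot leb O phi (partial n zeta) =
  dot lebd setT (fun x => phi (snoc x b)) (fun x => zeta (snoc x b)) -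
  dot lebd setT (fun x => phi (snoc x 0)) (fun x => zeta (snoc x 0)).
Proof.
move=> tphi tzeta.
have [/smoothP sphi _] := tphi; have [/smoothP szeta _] := tzeta.
have pE := partialM n (sphi 0) (szeta 0).
have sp := test_function_sqint mO tphi; have sz := test_function_sqint mO tzeta.
have sp' := test_function_sqint mO (test_function_partial n tphi).
have sz' := test_function_sqint mO (test_function_partial n tzeta).
have ip1 := sqint_mul mO sp sz'; have ip2 := sqint_mul mO sz sp'.
rewrite (dotC leb O (partial n phi) zeta) addrC /dot -RintegralD//
  -RintegralB//;
  do ?by apply: sqint_mul => //; exact: test_trace_sqint.
have C1 : Ck 1 (fun x => phi x * zeta x) := CkM (sphi 1) (szeta 1).
rewrite /Rintegral; congr fine; rewrite slab_fubini; last first.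
  have := integrableD mO ip1 ip2.
  by apply: eq_integrable => // x _ /=.
apply: eq_integral => x _; rewrite -(fiber_FTC x (CkW C1)).
  by apply: eq_integral => t _; rewrite pE.
exact: Ck_continuous (Ck_partial n C1).
Qed.

(* Affine in x_n with slope 1/b; for c = b its values at x_n = 0 and x_n = b are
   0 and 1, for c = 0 they are -1 and 0. *)
Definition trace_weight (c : R) (x : E) : R := b^-1 * x ord0 n + (c - b) / b.

(** The product rule for [D n] of [trace_weight c] times [V]. Its integral over a fibre is the
    difference of the end values of that product, which for c = 0 or c = b is the value of [V] at
    x_n = c. *)
Definition trace_density c V (x : E) : R :=
  trace_weight c x * D n V x + b^-1 * V x.

Lemma Ck_trace_weight c : Ck 0 (trace_weight c).
Proof.
split=> // [x|i x]; last by case: (is_derive_coord b^-1 ((c - b) / b) i n x).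
exact: (cvgD (cvgM (cvg_cst _) (@coord_continuous _ _ _ ord0 n x)) (cvg_cst _)).
Qed.

Lemma test_trace phi c x : c = 0 \/ c = b -> test_function setT phi ->
  phi (snoc x c) =
  fiber_int b (fun y => trace_weight c y * partial n phi y + b^-1 * phi y) x.
Proof.
move=> c0b [/smoothP sphi _].
have pE := partialM n (Ck_trace_weight c) (sphi 0).
have C0 := CkM (Ck_trace_weight c) (sphi 0).
have pw y : partial n (trace_weight c) y = b^-1.
  by rewrite /partial; have [_ ->] := is_derive_coord b^-1 ((c - b) / b) n n y;
    rewrite eqxx.
rewrite /fiber_int /Rintegral.
have E1 : (fun y => trace_weight c y * partial n phi y + b^-1 * phi y) =
    partial n (fun y => trace_weight c y * phi y).
  by rewrite pE; apply/funext => y; rewrite pw (mulrC b^-1).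
have cE1 : continuous (partial n (fun y => trace_weight c y * phi y)).
  have c1 := Ck_continuous (Ck_trace_weight c).
  have c2 := Ck_continuous (Ck_partial n (sphi 1)).
  have c3 := Ck_continuous (sphi 0).
  rewrite -E1 => y; exact: (cvgD (cvgM (c1 y) (c2 y)) (cvgM (cvg_cst _)
    (c3 y))).
under eq_integral do rewrite (congr1 (fun F : E -> R => F _) E1).
rewrite (fiber_FTC x C0 cE1)/= /trace_weight !mxE unlift_none.
have b0 : b != 0 by rewrite gt_eqF.
by case: c0b => ->; rewrite ?subrr ?sub0r ?mul0r ?mulr0 ?addr0 ?add0r ?mulNr
  ?divff// ?mulVf//; ring.
Qed.

Lemma trace_weight_le1 c x : c = 0 \/ c = b -> O x -> `|trace_weight c x| <= 1.
Proof.
rewrite /slab/= /trace_weight => c0b /andP[x0 xb].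
have E1 : b^-1 * x ord0 n = x ord0 n / b by rewrite mulrC.
have y0 : 0 < x ord0 n / b by rewrite divr_gt0.
have y1 : x ord0 n / b < 1 by rewrite ltr_pdivrMr// mul1r.
have b0 : b != 0 by rewrite gt_eqF.
rewrite E1 ler_norml; case: c0b => ->;
  rewrite ?subrr ?mul0r ?sub0r ?mulNr ?divff//.
  by apply/andP; split; lra.
by apply/andP; split; lra.
Qed.

Lemma measurable_trace_weight c : measurable_fun O (trace_weight c).
Proof.
apply: measurable_funS (continuous_measurable_rV _) => //.
exact: Ck_continuous (Ck_trace_weight c).
Qed.

Lemma sqint_trace_density c z V : c = 0 \/ c = b -> approx b z V ->
  sq (trace_density c V).
Proof.
move=> c0b [_ sV dV _ _]; apply: sqintD => //; last exact: sqintZ.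
apply: (sqint_bounded_mul mO (M := 1)); first exact: measurable_trace_weight.
  by move=> x; exact: trace_weight_le1.
by have [] := dV n.
Qed.

(** By [test_trace] the plane values of the approximants are fibre integrals of their densities,
    which are L^2-continuous in the H^1 norm. The limit depends on [V] alone and not on the sequence
    [z]: this is the uniqueness of traces. *)
Lemma approx_trace c z V : c = 0 \/ c = b -> approx b z V ->
  cvg_sqint lebd setT (fun m x => z m (snoc x c))
    (fiber_int b (trace_density c V)).
Proof.
move=> c0b az; have sd := sqint_trace_density c0b az.
have [tz sV dV cV cdV] := az; have [sdV _] := dV n.
have mw := measurable_trace_weight c.
have w1 x := @trace_weight_le1 c x c0b.
have sz m := approx_sqint m az.
have sdz m : sq (partial n (z m)) := approx_sqint_partial m n az.
pose F m (x : E) := trace_weight c x * partial n (z m) x + b^-1 * z m x.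
have swz m := sqint_bounded_mul mO mw w1 (sdz m).
have sbz m := sqintZ mO b^-1 (sz m).
have sF m : sq (F m) := sqintD mO (swz m) (sbz m).
have cw := cvg_sqintM mO mw w1 sdz sdV (cdV n).
have cb : cvg_sqint leb O (fun m x => b^-1 * z m x) (fun x => b^-1 * V x).
  by apply: (cvg_sqintM mO (M := `|b^-1|)) sz sV cV.
have cF : cvg_sqint leb O F (trace_density c V).
  exact: (cvg_sqintD mO swz (sqint_bounded_mul mO mw w1 sdV) sbz
    (sqintZ mO b^-1 sV) cw cb).
rewrite (_ : (fun m x => _) = fun m => fiber_int b (F m)).
  exact: cvg_fiber_int.
by apply/funext => m; apply/funext => x; exact: test_trace.
Qed.

(** The sequence that witnesses the bottom trace also converges on the top plane, by [approx_trace];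
    so the choice made by [trace] is not the junk value. *)
Lemma has_trace_top V : has_trace b 0 V (fun=> 0) ->
  has_trace b b V (trace b b V).
Proof.
move=> tV; have [z [az _ _]] := has_trace_approx tV.
have [tz sV dV cV cdV] := az; have [s1 _ _] := tV.
apply: xgetPex; exists (fiber_int b (trace_density b V)); split => //.
  by apply: sqint_fiber_int => //; apply: sqint_trace_density az; right.
by exists z; split => //; apply: approx_trace az; right.
Qed.

(** The limit of [green_test] along approximants [y] of [A] and [z] of [V]. *)
Lemma green A V (a w : 'rV[R]_d -> R) : has_trace b b A a ->
  has_trace b 0 V (fun=> 0) -> has_trace b b V w ->
  dot leb O (D n A) V + dot leb O A (D n V) = dot lebd setT a w.
Proof.
move=> /has_trace_approx[y [ay sa cya]] /has_trace_approx[z [az _ cz0]].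
move=> /has_trace_approx[z' [az' sw cz'w]].
have [ty sA dA cA cdA] := ay; have [tz sV dV cV cdV] := az.
have b0 : (0 : R) = 0 \/ (0 : R) = b by left.
have bb : b = 0 \/ b = b by right.
have sT c u U : c = 0 \/ c = b -> approx b u U ->
    sqint lebd setT (fiber_int b (trace_density c U)).
  by move=> hc au; apply: sqint_fiber_int => //; exact: sqint_trace_density au.
have str u U c m (au : approx b u U) : sqint lebd setT (fun x =>
  u m (snoc x c)).
  by have [tu _ _ _ _] := au; exact: test_trace_sqint.
have sy m := approx_sqint m ay; have sz m := approx_sqint m az.
have sdy m : sq (partial n (y m)) := approx_sqint_partial m n ay.
have sdz m : sq (partial n (z m)) := approx_sqint_partial m n az.
have L1 := cvg_dot mO sdy (dA n).1 sz sV (cdA n) cV.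
have L2' := cvg_dot mO sy sA sdz (dV n).1 cA (cdV n).
have mT : measurable [set: 'rV[R]_d] := measurableT.
have R1 := cvg_dot mT (str _ _ b ^~ ay) sa (str _ _ b ^~ az)
  (sT _ _ _ bb az) cya
  (approx_trace bb az).
(* No bottom value of [A] is prescribed, but [approx_trace] makes those of [y] converge; paired with
   those of [z], which tend to 0, they give no bottom term. *)
have R2 := cvg_dot mT (str _ _ 0 ^~ ay) (sT _ _ _ b0 ay) (str _ _ 0 ^~ az)
  (sqint0 lebd setT) (approx_trace b0 ay) cz0.
have E0 : dot lebd setT (fiber_int b (trace_density 0 A)) (fun=> 0) = 0.
  by rewrite dotC dot0l.
(* [z] witnesses the bottom trace and [z'] the top trace [w], a priori different sequences; the
   common limit from [approx_trace] identifies [w]. *)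
have Ew : dot lebd setT a (fiber_int b (trace_density b V)) = dot lebd setT a w.
  exact: (cvg_sqint_dot_unique mT (str _ _ b ^~ az') (sT _ _ _ bb az) sw sa
    (approx_trace bb az') cz'w).
pose s m := dot leb O (partial n (y m)) (z m) +
  dot leb O (y m) (partial n (z m)).
have cl : s m @[m --> \oo] --> dot leb O (D n A) V + dot leb O A (D n V).
  exact: cvgD L1 L2'.
have cr := cvgB R1 R2; rewrite Ew E0 subr0 in cr.
have sE : s = fun m =>
    dot lebd setT (fun x => y m (snoc x b)) (fun x => z m (snoc x b)) -
    dot lebd setT (fun x => y m (snoc x 0)) (fun x => z m (snoc x 0)).
  by apply/funext => m; exact: green_test.
have cr' : s m @[m --> \oo] --> dot lebd setT a w by rewrite sE; exact: cr.
exact: (cvg_seq_unique cl cr').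
Qed.

End green.

(** * The duality identity *)

Section duality.
Context (R : realType) (d : nat) (b : R).
Hypothesis b_gt0 : 0 < b.
Notation E := 'rV[R]_d.+1.
Notation leb := (lebesgue_rV R d.+1).
Notation lebd := (lebesgue_rV R d).
Notation O := (@slab R d b).
Notation n := (@ord_max d).
Notation D := (wderiv O).
Notation sq := (sqint leb O).
Notation ip := (dot leb O).
Notation bottom V := (has_trace b 0 V (fun=> 0)).
Implicit Types (A B V W p q psi phi : E -> R) (u v : 'I_d.+1 -> E -> R).

Let mO := @measurable_slab R d b.

Definition isH1 V := sq V /\ forall i, has_wderiv O i V.

Definition isH2 V := isH1 V /\ forall i, isH1 (D i V).

Lemma truncnDn (s : R) k : 0 <= s ->
    Num.truncn (s + k%:R) = (Num.truncn s + k)%N.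
Proof.
by move=> s0; rewrite addrC truncnD ?natrK 1?addnC.
Qed.

Lemma sobolev_isH1 s p : 0 <= s -> sobolev (s + 1) O p -> isH1 p.
Proof.
move=> s0; rewrite /sobolev (truncnDn 1 s0) addn1 => -[sp hp].
by split; [exact: sp|move=> i; have [h _] := hp i; exact: h].
Qed.

Lemma sobolev_isH2 s p : 0 <= s -> sobolev (s + 2) O p -> isH2 p.
Proof.
move=> s0; rewrite /sobolev (truncnDn 2 s0) addn2 => -[sp hp].
split; first by split; [exact: sp|move=> i; have [h _] := hp i; exact: h].
move=> i; have [_ [si hi]] := hp i.
by split; [exact: si|move=> j; have [h _] := hi j; exact: h].
Qed.

Lemma isH1_wderiv V i : isH1 V -> sq (D i V).
Proof. by move=> [_ /(_ i)[]]. Qed.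

Lemma isH1D A B : isH1 A -> isH1 B -> isH1 (fun x => A x + B x).
Proof.
move=> [sA dA] [sB dB]; split; first exact: sqintD.
by move=> i; apply: is_wderiv_has; exact: (is_wderivD mO sA sB (dA i) (dB i)).
Qed.

Lemma isH1Z c A : isH1 A -> isH1 (fun x => c * A x).
Proof.
move=> [sA dA]; split; first exact: sqintZ.
by move=> i; apply: is_wderiv_has; exact: (is_wderivZ c mO sA (dA i)).
Qed.

Lemma bottom_sq V : bottom V -> sq V.
Proof. by move=> /has_trace_approx[z [[]]]. Qed.

Lemma bottom_sqD V i : bottom V -> sq (D i V).
Proof. by move=> /has_trace_approx[z [[_ _ /(_ i)[]]]]. Qed.

(* The integral of [A V] over the top, defined even when [A] has no trace there;
   compare [bdry_trace]. *)
Definition bdry A V : R := ip (D n A) V + ip A (D n V).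

(** [wderiv] is a choice, so [D n] of a sum is not literally the sum of the [D n]. Any weak
    derivative may replace the chosen one under the pairing with [V], which makes [bdry] linear in
    [A]. *)
Lemma bdry_wderiv A W V : is_wderiv O n A W -> bottom V ->
  bdry A V = ip W V + ip A (D n V).
Proof.
move=> dA /has_trace_approx[z [az _ _]]; congr (_ + _).
have dA' := is_wderiv_has dA.
exact: (weq_dot dA'.1 dA.1 (is_wderiv_weq dA' dA) az).
Qed.

Lemma bdryD A B V : isH1 A -> isH1 B -> bottom V ->
  bdry (fun x => A x + B x) V = bdry A V + bdry B V.
Proof.
move=> hA hB bV; have [sA dA] := hA; have [sB dB] := hB.
rewrite (bdry_wderiv (is_wderivD mO sA sB (dA n) (dB n)) bV) /bdry.
have sV := bottom_sq bV; have sDV := bottom_sqD n bV.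
have sDA := isH1_wderiv n hA; have sDB := isH1_wderiv n hB.
by rewrite !dotDl// addrACA.
Qed.

Lemma bdryZ c A V : isH1 A -> bottom V ->
  bdry (fun x => c * A x) V = c * bdry A V.
Proof.
move=> hA bV; have [sA dA] := hA.
rewrite (bdry_wderiv (is_wderivZ c mO sA (dA n)) bV) /bdry.
have sV := bottom_sq bV; have sDV := bottom_sqD n bV;
  have sDA := isH1_wderiv n hA.
by rewrite !dotZl// mulrDr.
Qed.

Lemma isH1_sum m (F : 'I_m -> E -> R) : (forall i, isH1 (F i)) ->
  isH1 (fun x => \sum_i F i x).
Proof.
elim: m F => [|m IH] F hF.
  under eq_fun do rewrite big_ord0; split; first exact: sqint0.
  move=> i; apply: (is_wderiv_has (w := fun=> 0)); split; first exact: sqint0.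
  by move=> xi _; rewrite -!/(dot _ _ _ _) !dot0l oppr0.
by under eq_fun do rewrite big_ord_recl; apply: isH1D => //; exact: IH.
Qed.

Lemma bdry_sum m (F : 'I_m -> E -> R) V : (forall i, isH1 (F i)) -> bottom V ->
  bdry (fun x => \sum_i F i x) V = \sum_i bdry (F i) V.
Proof.
elim: m F => [|m IH] F hF bV.
  rewrite big_ord0; under eq_fun do rewrite big_ord0.
  have d0 : is_wderiv O n (fun=> 0 : R) (fun=> 0).
    split; first exact: sqint0.
    by move=> xi _; rewrite -!/(dot _ _ _ _) !dot0l oppr0.
  by rewrite (bdry_wderiv d0 bV) !dot0l addr0.
under eq_fun do rewrite big_ord_recl.
by rewrite bdryD//; [rewrite IH// big_ord_recl|exact: isH1_sum].
Qed.

Lemma ibp_tang A V i : i != n -> isH1 A -> bottom V ->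
  ip (D i A) V + ip A (D i V) = 0.
Proof.
move=> iN [sA dA] /has_trace_approx[z [az _ _]].
by rewrite (ibp_tangential iN sA (dA i) az) addNr.
Qed.

(** The tangential indices contribute nothing by [ibp_tang]; the normal one leaves the boundary
    term. *)
Lemma ibp_divergence (F : 'I_d.+1 -> E -> R) V : (forall i, isH1 (F i)) ->
  bottom V ->
  ip (diverg b F) V = bdry (F n) V - \sum_i ip (F i) (D i V).
Proof.
move=> hF bV; have sV := bottom_sq bV.
rewrite dot_suml//; last by move=> i; exact: isH1_wderiv.
apply/eqP; rewrite eq_sym subr_eq eq_sym -big_split/=; apply/eqP.
rewrite (bigD1 n)//= big1 ?addr0// => i iN.
exact: ibp_tang.
Qed.

(* Exchanging [D_n] and [D_i] in the first term of each summand, both cancel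
   with the second term of the other by integration by parts along x_i. *)
Lemma bdry_cross psi V i : i != n -> isH2 psi -> isH2 V -> bottom psi ->
    bottom V ->
  bdry (D i psi) V + bdry (D i V) psi = 0.
Proof.
have key (a1 a2 a3 a4 c1 c2 c3 c4 : R) : a1 = c1 -> a3 = c3 -> a2 = c2 ->
    a4 = c4 -> c1 + c4 = 0 -> c3 + c2 = 0 -> a1 + a2 + (a3 + a4) = 0.
  by move=> -> -> -> -> ? ?; lra.
move=> iN [[_ dpsi] hpsi] [[_ dV] hV] bpsi bV.
have [z [az _ _]] := has_trace_approx bpsi;
  have [y [ay _ _]] := has_trace_approx bV.
have m1 := weq_dot (isH1_wderiv n (hpsi i)) (isH1_wderiv i (hpsi n))
  (weq_mixed (dpsi n) (dpsi i) ((hpsi i).2 n) ((hpsi n).2 i)) ay.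
have m2 := weq_dot (isH1_wderiv n (hV i)) (isH1_wderiv i (hV n))
  (weq_mixed (dV n) (dV i) ((hV i).2 n) ((hV n).2 i)) az.
have t1 := ibp_tang iN (hpsi n) bV; have t2 := ibp_tang iN (hV n) bpsi.
exact: (key _ _ _ _ _ _ _ _ m1 m2 (dotC _ _ _ _) (dotC _ _ _ _) t1 t2).
Qed.

Lemma bdry_trace A V a : has_trace b b A a -> bottom V ->
  bdry A V = dot lebd setT a (trace b b V).
Proof.
by move=> tA bV; exact: (green b_gt0 tA bV (has_trace_top b_gt0 bV)).
Qed.

Lemma isH1_stress mu p u i j : isH1 p -> (forall k, isH2 (u k)) ->
  isH1 (stress b mu p u i j).
Proof.
move=> hp hu; rewrite /stress /symgrad.
rewrite (_ : (fun x => _) = fun x => (i == j)%:R * p x +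
    (- mu) * (D i (u j) x + D j (u i) x)); last first.
  by apply/funext => x; rewrite mulNr mulr_natl.
apply: isH1D; first exact: isH1Z.
by apply: isH1Z; apply: isH1D; [exact: (hu j).2|exact: (hu i).2].
Qed.

(** By the symmetry of Du this is one half of the integral of Du : Dv. *)
Definition viscous u v : R := \sum_j \sum_i ip (symgrad b u i j) (D i (v j)).

(** Expanded into two double sums, the first is symmetric termwise and the second after exchanging
    the summation indices. *)
Lemma viscousC u v : (forall k, isH2 (u k)) -> (forall k, isH2 (v k)) ->
  viscous u v = viscous v u.
Proof.
move=> hu hv; have su i j := isH1_wderiv i (hu j).1;
  have sv i j := isH1_wderiv i (hv j).1.
have E1 (w w' : 'I_d.+1 -> E -> R) : (forall i j, sq (D i (w j))) ->
    (forall i j, sq (D i (w' j))) -> viscous w w' =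
    \sum_j \sum_i ip (D i (w j)) (D i (w' j)) +
    \sum_j \sum_i ip (D j (w i)) (D i (w' j)).
  move=> sw sw'; rewrite -big_split; apply: eq_bigr => j _ /=.
  by rewrite -big_split; apply: eq_bigr => i _ /=; exact: dotDl.
have h1 : \sum_j \sum_i ip (D i (u j)) (D i (v j)) =
    \sum_j \sum_i ip (D i (v j)) (D i (u j)).
  by apply: eq_bigr => j _; apply: eq_bigr => i _; exact: dotC.
have h2 : \sum_j \sum_i ip (D j (u i)) (D i (v j)) =
    \sum_j \sum_i ip (D j (v i)) (D i (u j)).
  rewrite [LHS]exchange_big/=; apply: eq_bigr => j _.
  by apply: eq_bigr => i _; exact: dotC.
exact: (etrans (E1 _ _ su sv) (etrans (congr2 +%R h1 h2)
  (esym (E1 _ _ sv su)))).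
Qed.

Lemma stress_form mu p u v : isH1 p -> (forall k, isH2 (u k)) ->
  (forall k, isH2 (v k)) ->
  \sum_j \sum_i ip (stress b mu p u i j) (D i (v j)) =
  ip p (diverg b v) - mu * viscous u v.
Proof.
move=> [sp _] hu hv.
have su i j := isH1_wderiv i (hu j).1; have sv i j := isH1_wderiv i (hv j).1.
have sg i j : sq (symgrad b u i j) := sqintD mO (su i j) (su j i).
have e0 : ip p (diverg b v) = \sum_j ip (D j (v j)) p.
  by apply: (etrans (dotC _ _ _ _)); apply: dot_suml.
have e1 i j : ip (stress b mu p u i j) (D i (v j)) =
    (i == j)%:R * ip p (D i (v j)) - mu * ip (symgrad b u i j) (D i (v j)).
  have -> : stress b mu p u i j =
    fun x => (i == j)%:R * p x - mu * symgrad b u i j x.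
    by apply/funext => x; rewrite mulr_natl.
  have h1 := sqintZ mO (i == j)%:R sp; have h2 := sqintZ mO mu (sg i j).
  apply: (etrans (dotBl mO h1 h2 (sv i j))).
  by rewrite (dotZl mO _ sp (sv i j)) (dotZl mO _ (sg i j) (sv i j)).
rewrite e0 /viscous mulr_sumr -sumrB; apply: eq_bigr => j _.
under eq_bigr do rewrite e1.
rewrite sumrB -mulr_sumr (bigD1 j)//= eqxx mul1r big1 ?addr0 ?(dotC _ _ p)//.
by move=> i /negbTE ->; rewrite mul0r.
Qed.

Lemma stressC mu p u i j : stress b mu p u i j = stress b mu p u j i.
Proof.
apply/funext => x; rewrite /stress /symgrad.
by move: (D i (u j) x) (D j (u i) x) => y z; rewrite eq_sym (addrC y z).
Qed.

(** One statement for both systems: the drift coefficient is taken as [- gamma] in the primal one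
    and as [gamma] in the dual one. *)
Lemma momentum_test gamma mu p u v (F : 'I_d.+1 -> E -> R) : isH1 p ->
  (forall j, isH2 (u j)) -> (forall j, isH2 (v j)) ->
    (forall j, bottom (v j)) ->
  (forall j, measurable_fun O (F j)) ->
  (forall j, ae_eq leb O
    (fun x => gamma * D ord0 (u j) x + div_stress b mu p u j x) (F j)) ->
  (forall j, sq (F j)) /\
  \sum_j ip (F j) (v j) = gamma * \sum_j ip (D ord0 (u j)) (v j) +
    \sum_j bdry (stress b mu p u n j) (v j) -
    (ip p (diverg b v) - mu * viscous u v).
Proof.
move=> hp hu hv bv mF eF.
have hS i j := isH1_stress mu i j hp hu.
have sdS j : sq (div_stress b mu p u j).
  exact: (sqint_sum mO (fun i => isH1_wderiv i (hS i j))).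
have sD j := isH1_wderiv ord0 (hu j).1; have sV j := bottom_sq (bv j).
have sL j := sqintD mO (sqintZ mO gamma (sD j)) (sdS j).
split; first by move=> j; exact: ae_eq_sqint (mF j) (eF j) (sL j).
have E1 j : ip (F j) (v j) = gamma * ip (D ord0 (u j)) (v j) +
    bdry (stress b mu p u n j) (v j) -
    \sum_i ip (stress b mu p u i j) (D i (v j)).
  apply: (etrans (esym (eq_ae_dot mO (sL j) (sV j) (mF j) (eF j)))).
  apply: (etrans (dotDl mO (sqintZ mO gamma (sD j)) (sdS j) (sV j))).
  apply: (etrans (congr2 +%R (dotZl mO gamma (sD j) (sV j))
    (ibp_divergence (fun i => hS i j) (bv j)))).
  by rewrite addrA.
under eq_bigr do rewrite E1.
by rewrite sumrB big_split/= -mulr_sumr stress_form.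
Qed.

(** The Laplacian is the divergence of the gradient, so [ibp_divergence] applies to the components
    [D i psi]. *)
Lemma diffusion_test gamma kappa psi phi L : isH2 psi -> bottom phi ->
  measurable_fun O L ->
  ae_eq leb O (fun x => gamma * D ord0 psi x - kappa * laplacian b psi x) L ->
  sq L /\
  ip L phi = gamma * ip (D ord0 psi) phi - kappa * bdry (D n psi) phi +
    kappa * \sum_i ip (D i psi) (D i phi).
Proof.
move=> [hpsi h2psi] bphi mL eL.
have sD := isH1_wderiv ord0 hpsi; have sphi := bottom_sq bphi.
have slap : sq (laplacian b psi).
  exact: (sqint_sum mO (fun i => isH1_wderiv i (h2psi i))).
have s1 := sqintZ mO gamma sD; have s2 := sqintZ mO kappa slap.
have sL := sqintB mO s1 s2.
split; first exact: ae_eq_sqint mL eL sL.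
apply: (etrans (esym (eq_ae_dot mO sL sphi mL eL))).
apply: (etrans (dotBl mO s1 s2 sphi)).
rewrite (dotZl mO gamma sD sphi) (dotZl mO kappa slap sphi).
rewrite -addrA; congr (_ + _).
apply: (etrans (congr1 (fun r => - (kappa * r)) (ibp_divergence h2psi bphi))).
by rewrite mulrBr opprB addrC.
Qed.

End duality.

(** The common shape of both sides of the identity; on the boundary plane the last product enters
    with [-1 * h]. *)
Lemma Rintegral_duality d (T : measurableType d) (R : realType)
    (mu : {measure set T -> \bar R}) (U : set T) (mU : measurable U) m
    (F G : 'I_m -> T -> R) (f g h k : T -> R) :
  (forall i, sqint mu U (F i)) -> (forall i, sqint mu U (G i)) ->
  sqint mu U f -> sqint mu U g -> sqint mu U h -> sqint mu U k ->
  \int[mu]_(x in U) (\sum_i F i x * G i x - f x * g x + h x * k x) =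
  \sum_i dot mu U (F i) (G i) - dot mu U f g + dot mu U h k.
Proof.
move=> sF sG sf sg sh sk.
have ifg := sqint_mul mU sf sg; have ihk := sqint_mul mU sh sk.
have [iS ES] : mu.-integrable U (EFin \o (fun x => \sum_i F i x * G i x)) /\
    \int[mu]_(x in U) (\sum_i F i x * G i x) = \sum_i dot mu U (F i) (G i).
  elim: m F G sF sG => [|m IH] F G sF sG.
    under eq_fun do rewrite big_ord0.
    by rewrite /Rintegral big_ord0 integral0; split => //; exact: integrable0.
  have [iS ES] := IH _ _ (fun i => sF (lift ord0 i)) (fun i =>
    sG (lift ord0 i)).
  have i0 := sqint_mul mU (sF ord0) (sG ord0).
  under eq_fun do rewrite big_ord_recl.
  split; first exact: (integrableD mU i0 iS).
  by rewrite RintegralD// ES [RHS]big_ord_recl.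
have iSf : mu.-integrable U (EFin \o (fun x => \sum_i F i x * G i x -
  f x * g x)).
  exact: (integrableB mU iS ifg).
by rewrite RintegralD// RintegralB// ES.
Qed.

(* The dimension is n = d.+1, so that n >= 2 reads 0 < d. *)
Theorem proposition1p4 (R : realType) (d : nat) (d_gt0 : (0 < d)%N)
  (b gamma mu kappa sigma1 s : R)
  (b_gt0 : 0 < b) (mu_gt0 : 0 < mu) (kappa_gt0 : 0 < kappa) (s_ge0 : 0 <= s)
  (u : 'I_d.+1 -> 'rV[R]_d.+1 -> R) (p psi : 'rV[R]_d.+1 -> R)
  (Hu : forall j, sobolev0 b (s + 2) (u j)) (Hp : sobolev (s + 1) (slab b) p)
  (Hpsi : sobolev0 b (s + 2) psi)
  (f : 'I_d.+1 -> 'rV[R]_d.+1 -> R) (g l : 'rV[R]_d.+1 -> R)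
  (k : 'I_d.+1 -> 'rV[R]_d -> R) (h m : 'rV[R]_d -> R)
  (f_meas : forall j, measurable_fun (slab b) (f j))
  (g_meas : measurable_fun (slab b) g) (l_meas : measurable_fun (slab b) l)
  (primal : primal_system b gamma mu kappa sigma1 f g l k h m u p psi)
  (chi : 'rV[R]_d -> R) (Hchi : sobolev (s + 2^-1) setT chi)
  (v : 'I_d.+1 -> 'rV[R]_d.+1 -> R) (q phi : 'rV[R]_d.+1 -> R)
  (Hv : forall j, sobolev0 b (s + 2) (v j)) (Hq : sobolev (s + 1) (slab b) q)
  (Hphi : sobolev0 b (s + 2) phi)
  (dual : dual_system b gamma mu kappa sigma1 chi v q phi) :
  \int[lebesgue_rV R d.+1]_(x in slab b)
    (\sum_j f j x * v j x - g x * q x + l x * phi x) =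
  \int[lebesgue_rV R d]_(y in setT)
    (\sum_j k j y * trace b b (v j) y - m y * trace b b phi y - h y * chi y).
Proof.
(* The closing algebra over the reals: [a] and [c] stand for the drift terms, [V] and [G] for the
   viscous and heat forms, [BS], [BT] and [e] for the boundary terms, [C] for the surface tension
   terms. Products with a parameter are regrouped first, so that [lra] faces a linear problem. *)
have key (X a1 a2 BS BT V V' qg L c1 c2 e1 e2 G G' K C1 C2 M xh : R) :
    X = - gamma * a1 + BS - (0 - mu * V) ->
    0 = gamma * a2 + BT - (qg - mu * V') ->
    L = - gamma * c1 - kappa * e1 + kappa * G ->
    0 = gamma * c2 - kappa * e2 + kappa * G' ->
    V = V' -> G = G' -> a1 + a2 = 0 -> c1 + c2 = 0 ->
    BS = K - sigma1 * C1 -> BT = xh -> kappa * e1 = M ->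
    kappa * e2 + sigma1 * C2 = 0 -> C1 + C2 = 0 ->
    X - qg + L = K - M - xh.
  move=> -> E2 -> E4 EV EG Ea Ec -> ET EM EC EC12.
  have ga : gamma * a1 + gamma * a2 = 0 by rewrite -mulrDr Ea mulr0.
  have gc : gamma * c1 + gamma * c2 = 0 by rewrite -mulrDr Ec mulr0.
  have sC : sigma1 * C1 + sigma1 * C2 = 0 by rewrite -mulrDr EC12 mulr0.
  by subst V' G' BT M; lra.
pose O := @slab R d b; pose n := @ord_max d.
pose ip := dot (lebesgue_rV R d.+1) O.
pose D := wderiv O.
have mO : measurable O := measurable_slab b.
(* The drift direction x_1 is tangential because n >= 2. *)
have zN : (ord0 : 'I_d.+1) != n by rewrite -val_eqE/= eq_sym -lt0n.
have liftN (i : 'I_d) : lift n i != n by rewrite eq_sym neq_lift.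
have hu j := sobolev_isH2 s_ge0 (Hu j).1; have bu j := (Hu j).2.
have hv j := sobolev_isH2 s_ge0 (Hv j).1; have bv j := (Hv j).2.
have hpsi := sobolev_isH2 s_ge0 Hpsi.1; have bpsi := Hpsi.2.
have hphi := sobolev_isH2 s_ge0 Hphi.1; have bphi := Hphi.2.
have hp := sobolev_isH1 s_ge0 Hp; have hq := sobolev_isH1 s_ge0 Hq.
case: primal => Pmom Pdiv Pdif Pstr Pnor Pflux _ _.
case: dual => Qmom Qdiv Qdif Qtan Qnor Qflux _ _.
have m0 : measurable_fun O (fun=> 0 : R) by exact: measurable_cst.
have [sf X1] := momentum_test hp hu hv bv f_meas Pmom.
have [_ X2] := momentum_test hq hv hu bu (fun=> m0) Qmom.
have [sl X3] := diffusion_test hpsi bphi l_meas Pdif.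
have [_ X4] := diffusion_test hphi bpsi m0 Qdif.
have V0 : dot (lebesgue_rV R d.+1) (slab b) p (diverg b v) = 0.
  rewrite dotC -[RHS](dot0l (lebesgue_rV R d.+1) O p).
  apply: eq_ae_dot => //; first by apply: (sqint_sum mO) => i;
    exact: isH1_wderiv (hv i).1.
  exact: hp.1.
(* The dual pressure against the divergence of [u] is where the term g q comes from. *)
have g0 : dot (lebesgue_rV R d.+1) (slab b) q (diverg b u) =
    dot (lebesgue_rV R d.+1) (slab b) g q.
  rewrite dotC.
  apply: eq_ae_dot => //; first by apply: (sqint_sum mO) => i;
    exact: isH1_wderiv (hu i).1.
  exact: hq.1.
pose ipd := dot (lebesgue_rV R d) setT.
pose w j := trace b b (v j).
(* The hypotheses give a trace to the stress and the surface tension only in combination. The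
   linearity of [bdry] separates the two, leaving the surface tension as a [bdry] term. *)
have BSE : \sum_j bdry b (stress b mu p u n j) (v j) =
    \sum_j ipd (k j) (w j) -
    sigma1 * \sum_(i < d) bdry b (D (lift n i) psi) (v (lift n i)).
  have big_lift (F : 'I_d.+1 -> R) :
      \sum_j F j = F n + \sum_(i < d) F (lift n i) by rewrite (bigD1_ord n).
  have Bn : bdry b (stress b mu p u n n) (v n) = ipd (k n) (w n).
    apply: (etrans _ (bdry_trace b_gt0 (Pstr n) (bv n))).
    apply: (congr1 (fun A => bdry b A (v n))); apply/funext => x.
    by rewrite /hgrad eqxx mulr0 addr0.
  have Bi (i : 'I_d) : bdry b (stress b mu p u n (lift n i)) (v (lift n i)) =
      ipd (k (lift n i)) (w (lift n i)) -
      sigma1 * bdry b (D (lift n i) psi) (v (lift n i)).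
    have hS := isH1_stress mu (lift n i) n hp hu; have hD := hpsi.2 (lift n i).
    apply/eqP; rewrite eq_sym subr_eq eq_sym; apply/eqP.
    apply: (etrans _ (bdry_trace b_gt0 (Pstr (lift n i)) (bv (lift n i)))).
    apply: (etrans _ (etrans (esym (bdryD hS (isH1Z sigma1 hD)
      (bv (lift n i)))) _)).
      apply: (congr2 +%R); last exact: esym (bdryZ sigma1 hD (bv (lift n i))).
      exact: (congr1 (fun A => bdry b A _) (stressC _ _ _ _ _ _)).
    apply: (congr1 (fun A => bdry b A (v (lift n i)))); apply/funext => x.
    by rewrite /hgrad (negbTE (liftN i)).
  rewrite big_lift [X in _ = X - _]big_lift mulr_sumr -[RHS]addrA -sumrB.
  exact: (congr2 +%R Bn (eq_bigr _ (fun i _ => Bi i))).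
(* Only the normal component survives, the tangential dual stress having zero trace; there [green]
   is used directly, with [h] as the top trace of the normal velocity. *)
have BTE : \sum_j bdry b (stress b mu q v n j) (u j) = ipd h chi.
  rewrite (bigD1 n)//= big1 ?addr0 => [|j jN].
    by rewrite /ipd dotC; exact: (green b_gt0 Qnor (bu n) Pnor).
  rewrite stressC (bdry_trace b_gt0 (Qtan j jN) (bu j)).
  by rewrite dot0l.
have PF : kappa * bdry b (D n psi) phi = ipd m (trace b b phi).
  by rewrite -(bdryZ kappa (hpsi.2 n) bphi); exact: bdry_trace.
(* Again only the combined flux has a known trace, so the two terms are assembled inside a single
   [bdry]. *)
have QF : kappa * bdry b (D n phi) psi +
    sigma1 * \sum_(i < d) bdry b (D (lift n i) (v (lift n i))) psi = 0.
  have hDv (i : 'I_d) := (hv (lift n i)).2 (lift n i).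
  rewrite -(bdryZ kappa (hphi.2 n) bpsi) -(bdry_sum hDv bpsi).
  rewrite -(bdryZ sigma1 (isH1_sum hDv) bpsi).
  rewrite -(bdryD (isH1Z kappa (hphi.2 n)) (isH1Z sigma1 (isH1_sum hDv)) bpsi).
  by rewrite (bdry_trace b_gt0 Qflux bpsi) dot0l.
have C12 : \sum_(i < d) bdry b (D (lift n i) psi) (v (lift n i)) +
    \sum_(i < d) bdry b (D (lift n i) (v (lift n i))) psi = 0.
  rewrite -big_split/=; apply: big1 => i _.
  exact: (bdry_cross (liftN i) hpsi (hv _) bpsi (bv _)).
have A12 : \sum_j ip (D ord0 (u j)) (v j) + \sum_j ip (D ord0 (v j)) (u j) = 0.
  rewrite -big_split/=; apply: big1 => j _.
  apply: etrans (ibp_tang zN (hu j).1 (bv j)).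
  exact: (congr1 (+%R _) (dotC _ _ _ _)).
have c12 : ip (D ord0 psi) phi + ip (D ord0 phi) psi = 0.
  apply: etrans (ibp_tang zN hpsi.1 bphi).
  exact: (congr1 (+%R _) (dotC _ _ _ _)).
have GG : \sum_i ip (D i psi) (D i phi) = \sum_i ip (D i phi) (D i psi).
  by apply: eq_bigr => i _; exact: dotC.
have sk j : sqint (lebesgue_rV R d) setT (k j) by case: (Pstr j).
have sw j : sqint (lebesgue_rV R d) setT (w j).
  by case: (has_trace_top b_gt0 (bv j)).
have sm : sqint (lebesgue_rV R d) setT m by case: Pflux.
have sphi : sqint (lebesgue_rV R d) setT (trace b b phi).
  by case: (has_trace_top b_gt0 bphi).
have sh : sqint (lebesgue_rV R d) setT h by case: Pnor.
have schi : sqint (lebesgue_rV R d) setT chi by case: Qnor.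
have sg : sqint (lebesgue_rV R d.+1) O g.
  exact: ae_eq_sqint g_meas Pdiv (sqint_sum mO (fun i =>
    isH1_wderiv i (hu i).1)).
have mT : measurable [set: 'rV[R]_d] := measurableT.
rewrite (Rintegral_duality mO sf (fun j => bottom_sq (bv j)) sg hq.1 sl
  (bottom_sq bphi)).
have -> : \int[lebesgue_rV R d]_(y in setT)
    (\sum_j k j y * trace b b (v j) y - m y * trace b b phi y - h y * chi y) =
    \int[lebesgue_rV R d]_(y in setT)
    (\sum_j k j y * w j y - m y * trace b b phi y + (-1 * h y) * chi y).
  by apply: eq_Rintegral => y _; rewrite mulN1r mulNr.
rewrite (Rintegral_duality mT sk sw sm sphi (sqintZ mT (-1) sh) schi).
rewrite (dotZl mT (-1) sh schi) mulN1r.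
have X2' : \sum_j dot (lebesgue_rV R d.+1) (slab b) (fun=> 0) (u j) = 0.
  by apply: big1 => j _; exact: dot0l.
have X4' : dot (lebesgue_rV R d.+1) (slab b) (fun=> 0) psi = 0 by exact: dot0l.
rewrite V0 in X1; rewrite X2' g0 in X2; rewrite X4' in X4.
exact: (key _ _ _ _ _ _ _ _ _ _ _ _ _ _ _ _ _ _ _ _ X1 X2 X3 X4
  (viscousC hu hv) GG A12 c12 BSE BTE PF QF C12).
Qed.
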